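(* Suppose that there are constants $c>0$ and $Q>0$ such that $$\frac{\mu(B(y,r))}{\mu(B(x,R))}\ge c\Big(\frac rR\Big)^Q\quad\text{for every } x\in\mathcal P,\ 0<r\le R,\ y\in B(x,R).$$ Let $0<s\le1$, $0<p,q<\infty$ and let $u\in\dot M^{s,L^{p,q}}(\mathcal P)$ be quasicontinuous (with respect to the $M^{s,L^{p,q}}$-capacity). Then quasievery point is a generalized Lebesgue point of $u$. Moreover, if $p>Q/(Q+s)$, then quasievery point is a Lebesgue point of $u$.
   Context: Space. $\mathcal P=(\mathcal P,d,\mu)$ is a metric space $(\mathcal P,d)$ with a Borel regular outer measure $\mu$ such that every ball $B(x,r)=\{y\in\mathcal P: d(y,x)<r\}$ ($r>0$) has positive and finite measure, and $\mu$ is doubling: there is a constant $c_d>0$ with $\mu(B(x,2r))\le c_d\,\mu(B(x,r))$ for all $x\in\mathcal P$, $r>0$. $L^0=L^0(\mathcal P)$ is the set of measurable, almost everywhere finite functions $u:\mathcal P\to[-\infty,\infty]$. Lorentz space. For $0<p,q<\infty$, $\|u\|_{L^{p,q}}=\big(\int_0^\infty\lambda^q\mu(\{x\in\mathcal P:|u(x)|>\lambda\})^{q/p}\frac{d\lambda}{\lambda}\big)^{1/q}$ and $L^{p,q}=\{u\in L^0:\|u\|_{L^{p,q}}<\infty\}$. Hajłasz spaces (applied with $X=L^{p,q}$). A measurable $g:\mathcal P\to[0,\infty]$ is an $s$-gradient of $u\in L^0$ if there is $E\subset\mathcal P$ with $\mu(E)=0$ such that $|u(x)-u(y)|\le d(x,y)^s(g(x)+g(y))$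 for all $x,y\in\mathcal P\setminus E$. $\mathcal D^s(u)$ is the set of all $s$-gradients of $u$. $\dot M^{s,X}$ consists of measurable $u$ with $\|u\|_{\dot M^{s,X}}=\inf_{g\in\mathcal D^s(u)}\|g\|_X<\infty$; $M^{s,X}=\dot M^{s,X}\cap X$ with $\|u\|_{M^{s,X}}=\|u\|_X+\|u\|_{\dot M^{s,X}}$. Capacity. $C_{M^{s,X}}(E)=\inf\{\|u\|_{M^{s,X}}: u\in M^{s,X},\ u\ge1 \text{ on a neighbourhood of } E\}$. A property holds for quasievery point (quasieverywhere) if it holds outside a set of $M^{s,X}$-capacity zero. A function $u:\mathcal P\to[-\infty,\infty]$ is quasicontinuous if for every $\varepsilon>0$ there is $E\subset\mathcal P$ with $C_{M^{s,X}}(E)<\varepsilon$ such that the restriction of $u$ to $\mathcal P\setminus E$ is continuous. Medians and Lebesgue points. For $0<\gamma<1$, measurable $u$ and a set $A$ of finite measure, $m_u^\gamma(A)=\inf\{a\in\mathbb R:\mu(\{x\in A:u(x)>a\})<\gamma\mu(A)\}$. A point $x$ is a Lebesgue point of $u$ if $\lim_{r\to0}\frac1{\mu(B(x,r))}\int_{B(x,r)}u\,d\mu=u(x)$. It is a generalized Lebesgue point of $u$ if $\lim_{r\to0}m^\gamma_{|u-u(x)|}(B(x,r))=0$ and $\lim_{r\to0}m^\gamma_u(B(x,r))=u(x)$ for every $0<\gamma<1$. *)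

(* Defs.v *)
From HB Require Import structures.
From mathcomp Require Import all_boot all_order all_algebra.
From mathcomp Require Import all_classical all_reals all_analysis.
From mathcomp Require Import measurable_realfun.

Set Implicit Arguments.
Unset Strict Implicit.
Unset Printing Implicit Defensive.

Import Order.TTheory GRing.Theory Num.Theory.
Import numFieldNormedType.Exports.

Local Open Scope classical_set_scope.
Local Open Scope ring_scope.

(* Nonempty metric spaces: the library equips [caratheodory_type mu] with its
   sigma-algebra only over a pointed carrier. *)
#[short(type="pointedMetricType")]
HB.structure Definition PointedMetric (K : numDomainType) :=
  { M of Metric K M & isPointed M }.

Section space.
Context {R : realType} {T : pointedMetricType R}.
Variable mu : {outer_measure set T -> \bar R}.
Local Open Scope ereal_scope.

(* Borel sets are [mu]-measurable, and every set has a Borel hull of the same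
   measure. *)
Definition borel_regular : Prop :=
  (forall B : set T, <<s [set U : set T | open U] >> B ->
     mu.-caratheodory B) /\
  (forall A : set T, exists B : set T,
     [/\ <<s [set U : set T | open U] >> B, A `<=` B & mu B = mu A]).

Definition balls_pos_finite : Prop :=
  forall (x : T) (r : R), (0 < r)%R ->
    0 < mu (ball x r) /\ mu (ball x r) < +oo.

Definition doubling : Prop :=
  exists2 cd : R, (0 < cd)%R &
    forall (x : T) (r : R), (0 < r)%R ->
      mu (ball x (2 * r)%R) <= cd%:E * mu (ball x r).

Definition mu_measurable (u : T -> \bar R) : Prop :=
  measurable_fun [set: caratheodory_type mu]
    (u : caratheodory_type mu -> \bar R).

Definition mu_integral (A : set T) (u : T -> \bar R) : \bar R :=
  \int[mu : set (caratheodory_type mu) -> \bar R]_(x in A) u x.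

Definition L0 : set (T -> \bar R) :=
  [set u | mu_measurable u /\ mu [set x | `|u x| = +oo] = 0].

Definition lorentz_norm (p q : R) (u : T -> \bar R) : \bar R :=
  (\int[lebesgue_measure]_(l in `]0%R, +oo[)
     ((l `^ q)%:E * mu [set x | l%:E < `|u x|] `^ (q / p) * (l^-1)%:E))
  `^ q^-1.

Definition sgradient (s : R) (u : T -> \bar R) : set (T -> \bar R) :=
  [set g | [/\ mu_measurable g, forall x, 0 <= g x
    & exists2 E : set T, mu E = 0 &
      forall x y, ~ E x -> ~ E y ->
        `|u x - u y| <= (mdist x y `^ s)%:E * (g x + g y)]].

(* The function space X enters through its norm functional, extended by +oo:
   X is the set of those u in L^0 with [norm u < +oo]. *)
Section hajlasz.
Variables (norm : (T -> \bar R) -> \bar R) (s : R).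

Definition hajlasz_hom_norm (u : T -> \bar R) : \bar R :=
  ereal_inf [set norm g | g in sgradient s u].

Definition hajlasz_hom : set (T -> \bar R) :=
  [set u | L0 u /\ hajlasz_hom_norm u < +oo].

Definition hajlasz_norm (u : T -> \bar R) : \bar R :=
  norm u + hajlasz_hom_norm u.

Definition hajlasz : set (T -> \bar R) :=
  [set u | hajlasz_hom u /\ norm u < +oo].

Definition capacity (E : set T) : \bar R :=
  ereal_inf [set hajlasz_norm u | u in
    [set u | hajlasz u /\
       exists U : set T, [/\ open U, E `<=` U & forall x, U x -> 1 <= u x]]].

Definition quasieverywhere (P : T -> Prop) : Prop :=
  exists2 E : set T, capacity E = 0 & forall x, ~ E x -> P x.

Definition quasicontinuous (u : T -> \bar R) : Prop :=
  forall eps : R, (0 < eps)%R ->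
    exists2 E : set T, capacity E < eps%:E & {within ~` E, continuous u}.

End hajlasz.

Definition median (gamma : R) (u : T -> \bar R) (A : set T) : \bar R :=
  ereal_inf [set a%:E | a in
    [set a : R | mu (A `&` [set x | a%:E < u x]) < gamma%:E * mu A]].

(* The integral means must make sense for small r, that is, not be of the form
   oo - oo, a case in which the library's integral has a default value. *)
Definition lebesgue_point (u : T -> \bar R) (x : T) : Prop :=
  (\forall r \near (0%R : R)^'+,
     mu_integral (ball x r) u^\+ +? - mu_integral (ball x r) u^\-) /\
  ((mu (ball x r))^-1 * mu_integral (ball x r) u @[r --> (0%R : R)^'+] --> u x).

(* If u x is infinite then [`|u y - u x|] is +oo for every y (in [\bar R],
   oo - oo = -oo), so the first limit fails and x is not a generalized
   Lebesgue point. *)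
Definition gen_lebesgue_point (u : T -> \bar R) (x : T) : Prop :=
  forall gamma : R, (0 < gamma < 1)%R ->
    (median gamma (fun y => `|u y - u x|) (ball x r)
       @[r --> (0%R : R)^'+] --> 0) /\
    (median gamma u (ball x r) @[r --> (0%R : R)^'+] --> u x).

End space.

(* Main.v *)
Require Import Defs.
From mathcomp Require Import all_boot all_order all_algebra.
From mathcomp Require Import all_classical all_reals all_analysis.
From mathcomp Require Import measurable_realfun ring lra.
Import Order.TTheory GRing.Theory Num.Theory.
Import numFieldNormedType.Exports.
Local Open Scope classical_set_scope.
Local Open Scope ring_scope.

(**
The capacity is handled through a substitute that is stable under countable
unions.  A set A is controlled by h if some v with 0 <= v <= 1 and v = 1 on A
satisfies v <= h and v x <= v y + d(x,y)^s (h x + h y) off a null set, so that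
h bounds both v and an s-gradient of v.  The supremum of the v_n shows that a
union of sets controlled by h_n is controlled by the supremum of the h_n
[controlled_bigcup], and the q-th power of the Lorentz quasinorm of a supremum
is at most a weighted sum of those of its terms [lorentz_int_sum]; this
replaces the countable subadditivity that a quasinorm lacks.  A set is polar
if it lies in open sets controlled by functions of arbitrarily small norm.
Polar sets are stable under countable unions [polar_bigcup] and have capacity
zero [polar_capacity]; sets of small capacity lie in open sets controlled by a
small function [capacity_lt_controlled].

All exceptional sets are shown to be polar by one covering argument.  Take a
family of balls B(z,r), r <= 1, in each of which a function g exceeds
eta r^-s on a fixed proportion of the measure.  The function
h = sup r^-s 1_{B(z,2r)} controls the union of the balls, and Vitali covering
together with doubling bounds mu{h > l} by a multiple of mu{g > eta l}, hence
the norm of h by that of g [controlled_dense_balls].  If the balls meet,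
instead, a set A controlled by (v, h) in a fixed proportion, then either h is
large on a fixed proportion of the ball, which is the previous case, or some
point z' of A in the ball has small h z'; the inequality between z', where
v = 1, and a point x of the doubled ball then forces v x >= 1/2 or
h x >= r^-s / 12, so that 12 h controls the union [controlled_density].

Generalized Lebesgue points: u is continuous off sets E of small capacity.
The points at which E has density at least gamma at arbitrarily small scales
lie in the union of balls just described, so quasieverywhere |u - u x| <= d
off a set of density less than gamma at x, for every d and gamma
[polar_not_dens_close_all].  The points with |u| infinite are polar as well,
because by quasicontinuity |u| > 2l near them up to a small set, and a
truncation of |u| / l controls this superlevel set [polar_infinite].  Medians
do not see sets of small density, which gives the first claim.

Lebesgue points: let g be a gradient of u in the Lorentz space and
Q/(Q+s) < p1 < p.  Quasieverywhere, in all small balls B = B(x,r) and for all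
j, the set {g > L^j eta r^-s} has relative measure less than theta L^(-j p1)
[polar_bad_levels]: as p1 < p, the balls that fail at level j cost a geometric
factor in j when L is large, and g may be replaced by g 1_{g > n}, which is
small.  By the lower mass bound a ball of radius about r L^(-j p1/Q) inside B
is too large for that set to contain it, so it has a point with
g <= L^j eta r^-s.  Chaining such points from y up to a point where u is close
to u x gives |u y - u x| <= eps + 4 eta + sum_j a_j 1_{g > L^j eta r^-s}(y)
with a_j a multiple of eta L^(j (1 - s p1/Q)) [chain_bound].  Integration
turns the sum into a geometric series of ratio L^(1 - s p1/Q - p1), and this
is less than 1 exactly because p1 > Q/(Q+s) [chain_integral].  The mean
oscillation of u at x is thus at most a constant times eps + eta.
*)

Set Implicit Arguments.
Unset Strict Implicit.
Unset Printing Implicit Defensive.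

(** * The q-th power of the Lorentz quasinorm *)

Lemma le_poweR {R : realType} (r : R) (x y : \bar R) : 0 <= r ->
  (0 <= x)%E -> (x <= y)%E -> (x `^ r <= y `^ r)%E.
Proof.
move=> r0 x0 xy; apply: gt0_ler_poweR => //; rewrite in_itv/= leey andbT//.
exact: le_trans xy.
Qed.

Section PowerIntegral.
Context {R : realType} (q : R).
Hypothesis q0 : 0 < q.
Local Notation leb := (@lebesgue_measure R).

Let powR_is_derive (x : R) : 0 < x -> forall a : R,
  is_derive x 1 (@powR R ^~ a) (a * x `^ (a - 1)).
Proof. by move=> x0 a; exact: (@is_derive1_powR R). Qed.

Lemma continuous_powR_gt0 (a x : R) : 0 < x -> {for x, continuous (@powR R ^~ a)}.
Proof.
move=> x0; apply: differentiable_continuous; apply/derivable1_diffP.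
by have [] := powR_is_derive x0 a.
Qed.

Let integral_powR_itv (e : R) : 0 < e < 1 ->
  (\int[leb]_(l in `[e, 1%R]) (q * l `^ (q - 1))%:E = (1 - e `^ q)%:E)%E.
Proof.
move=> /andP[e0 e1].
rewrite (@continuous_FTC2 _ _ (@powR R ^~ q))//.
- by rewrite powR1 EFinB.
- apply: continuous_in_subspaceT => x; rewrite inE/= in_itv/= => /andP[ex _].
  by apply: cvgM; [exact: cvg_cst|apply: continuous_powR_gt0; exact: lt_le_trans ex].
- split.
  + move=> x; rewrite in_itv/= => /andP[ex _].
    by have [] := powR_is_derive (lt_trans e0 ex) q.
  + by apply: cvg_at_right_filter; exact: continuous_powR_gt0.
  + by apply: cvg_at_left_filter; exact: continuous_powR_gt0.
- move=> x; rewrite in_itv/= => /andP[ex _].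
  by rewrite powR_derive1// in_itv/= andbT (lt_trans e0 ex).
Qed.

Lemma cvg_harmonic_powR : (n.+1%:R^-1 : R) `^ q @[n --> \oo] --> (0 : R).
Proof.
have /cvg_at_rightP := @powR_cvg0 R q q0; apply; split => [n|].
  by rewrite invr_gt0.
exact: cvg_harmonic.
Qed.

(** The integrand is unbounded at 0 when q < 1, so the fundamental theorem is
    applied on [e, 1] and e tends to 0. *)
Lemma integral_powR01 :
  (\int[leb]_(l in `]0%R, 1%R]) (q * l `^ (q - 1))%:E = 1)%E.
Proof.
pose A (n : nat) : set R := `[n.+2%:R^-1, 1]%classic.
have mf (D : set R) : measurable_fun D (fun l : R => (q * l `^ (q - 1))%:E).
  apply/measurable_EFinP; apply: measurable_funTS.
  by apply: measurable_funM => //; exact: measurable_powR.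
have AE : \bigcup_n A n = `]0, 1]%classic.
  apply/seteqP; split => [x [n _]|x]; rewrite /A/= !in_itv/=.
    by move=> /andP[+ ->]; rewrite andbT; apply: lt_le_trans; rewrite invr_gt0.
  move=> /andP[x0 x1]; exists (Num.truncn x^-1) => //=; rewrite in_itv/= x1 andbT.
  rewrite invf_ple ?posrE// ltW// (lt_trans (truncnS_gt _))// ltr_nat//.
have : (\int[leb]_(x in A n) (q * x `^ (q - 1))%:E @[n --> \oo] -->
     \int[leb]_(x in \bigcup_n A n) (q * x `^ (q - 1))%:E)%E.
  apply: ge0_nondecreasing_set_cvg_integral => //.
  - apply/nondecreasing_seqP => n; rewrite subsetEset => x; rewrite /A/= !in_itv/=.
    move=> /andP[+ ->]; rewrite andbT; apply: le_trans.
    by rewrite lef_pV2 ?posrE// ler_nat.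
  - by move=> n; exact: measurable_itv.
  - by move=> n; exact: mf.
  - by move=> n x _; rewrite lee_fin mulr_ge0 ?powR_ge0// ltW.
rewrite AE => cA; apply: (cvg_unique _ cA) => //.
have -> : (fun n => \int[leb]_(x in A n) (q * x `^ (q - 1))%:E)%E =
    (fun n : nat => (1 - (n.+2%:R^-1) `^ q)%:E).
  apply/funext => n; rewrite integral_powR_itv// invr_gt0 ltr0n/=.
  by rewrite invf_lt1// ltr1n.
apply: cvg_EFin; first by near=> n.
rewrite -[X in _ --> X]subr0; apply: cvgB; first exact: cvg_cst.
by rewrite (cvg_shiftS (fun n => n.+1%:R^-1 `^ q)); exact: cvg_harmonic_powR.
Unshelve. all: by end_near. Qed.
End PowerIntegral.

Section LorentzFunctional.
Context {R : realType}.
Variables (p q : R).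
Hypotheses (p0 : 0 < p) (q0 : 0 < q).
Local Open Scope ereal_scope.
Local Notation leb := (@lebesgue_measure R).
Let t := (q / p)%R.
Let t0 : (0 < t)%R. Proof. exact: divr_gt0. Qed.

(** The q-th power of the Lorentz quasinorm, as a functional of the distribution
    function alone: all estimates of the norm come from the distribution
    function. *)
Definition lorentz_int (F : R -> \bar R) : \bar R :=
  \int[leb]_(l in `]0%R, +oo[) ((l `^ q)%:E * F l `^ (q / p) * (l^-1)%:E).

(** The two properties of distribution functions that make the integrand of
    [lorentz_int] measurable and the functional monotone. *)
Definition is_distr (F : R -> \bar R) :=
  (forall l, 0 <= F l) /\ (forall x y, (x <= y)%R -> F y <= F x).

Lemma lorentz_intE F : lorentz_int F =
  \int[leb]_(l in `]0%R, +oo[) ((l `^ (q - 1))%:E * F l `^ t).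
Proof.
apply: eq_integral => l; rewrite inE/= in_itv/= andbT => l0.
by rewrite muleAC -EFinM powRB ?(gt_eqF l0) ?implybT// powRr1 ?ltW.
Qed.

(** The superlevel sets are intervals. *)
Lemma nonincreasing_emeasurable (D : set R) (F : R -> \bar R) : measurable D ->
  (forall x y, (x <= y)%R -> F y <= F x) -> measurable_fun D F.
Proof.
move=> mD ni; apply: measurable_funTS.
apply: (measurability (@ErealGenCInfty.G R)) => [|/= _ [_] [r] -> <-].
  exact: ErealGenCInfty.measurableE.
apply: measurableI => //; apply: is_interval_measurable => a b /=.
rewrite !in_itv/= !andbT => ra rb u /andP[_ ub].
by rewrite in_itv/= andbT (le_trans rb)// ni.
Qed.

Let mF (D : set R) F : measurable D -> is_distr F ->
  measurable_fun D (fun l => (l `^ (q - 1))%:E * F l `^ t).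
Proof.
move=> mD [F0 Fn]; apply: emeasurable_funM.
  by apply/measurable_EFinP; apply: measurable_funTS; exact: measurable_powR.
apply: nonincreasing_emeasurable => // x y xy.
by apply: le_poweR; [exact: ltW| |exact: Fn].
Qed.

Let F_ge0 F l : 0 <= (l `^ (q - 1))%:E * F l `^ t.
Proof. by rewrite mule_ge0// ?poweR_ge0// lee_fin powR_ge0. Qed.
Local Hint Resolve F_ge0 : core.

Lemma lorentz_int_ge0 F : 0 <= lorentz_int F.
Proof. by rewrite lorentz_intE integral_ge0. Qed.

Lemma le_lorentz_int F G : is_distr F -> is_distr G ->
  (forall l, (0 < l)%R -> F l <= G l) -> lorentz_int F <= lorentz_int G.
Proof.
move=> dF dG FG; rewrite !lorentz_intE; apply: ge0_le_integral => //.
- exact: mF.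
- exact: mF.
- move=> l /=; rewrite in_itv/= andbT => l0; rewrite lee_pmul ?poweR_ge0//.
    by rewrite lee_fin powR_ge0.
  by apply: le_poweR; [exact: ltW|by case: dF|exact: FG].
Qed.

(** The measure dl / l is invariant under dilations, so only l^q is rescaled. *)
Lemma lorentz_int_scale F (a : R) : is_distr F -> (0 < a)%R ->
  lorentz_int (fun l => F (a * l)%R) = (a `^ (- q))%:E * lorentz_int F.
Proof.
move=> dF a0.
pose phi : measurableTypeR R -> measurableTypeR R := fun x => (a * x)%R.
have mphi : measurable_fun setT phi by exact: mulrl_measurable.
pose an : {nonneg R} := NngNum (ltW a0).
pose m : {measure set (measurableTypeR R) -> \bar R} := mscale an (pushforward leb phi).
have mE A : measurable A -> leb A = m mphi A.
  apply: lebesgue_measure_unique => _ [[x y]] _ <-.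
  change (leb `]x, y]%classic = a%:E * leb (phi @^-1` `]x, y]%classic)).
  rewrite (_ : phi @^-1` _ = `](a^-1 * x)%R, (a^-1 * y)%R]%classic); last first.
    apply/seteqP; split => z /=; rewrite !in_itv/= /phi;
      by rewrite ler_pdivlMl// ltr_pdivrMl.
  rewrite !lebesgue_measure_itv/= !lte_fin ltr_pM2l ?invr_gt0//.
  case: ifPn; rewrite ?mule0// => xy; rewrite -!EFinD -EFinM -mulrBr mulrA.
  by rewrite divff ?gt_eqF// mul1r.
rewrite !lorentz_intE.
rewrite [in RHS](eq_measure_integral (m mphi)); last by move=> A mA _; exact: mE.
have mFF : measurable_fun (`]0%R, +oo[%classic : set R) (fun l : R => (l `^ (q - 1))%:E * F l `^ t).
  exact: mF.
rewrite ge0_integral_mscale//=.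
rewrite (@ge0_integral_pushforward _ _ (measurableTypeR R) (measurableTypeR R) R phi mphi leb `]0%R, +oo[%classic)//.
have -> : phi @^-1` (`]0%R, +oo[%classic : set R) = (`]0%R, +oo[%classic : set R).
  by apply/seteqP; split => z; rewrite /= !in_itv/= /phi !andbT pmulr_rgt0.
rewrite muleA -EFinM.
rewrite -ge0_integralZl//.
- apply: eq_integral => l; rewrite inE/= in_itv/= andbT => l0.
  rewrite /phi muleA -EFinM; congr (_%:E * _).
  rewrite powRM ?ltW// mulrA -(mulrA (a `^ (- q))%R) mulr_powRB1 ?ltW//.
  by rewrite powRN mulVf ?mul1r// gt_eqF// powR_gt0.
- apply: emeasurable_funM.
    apply/measurable_EFinP; apply: measurable_funTS.
    by apply: (measurableT_comp (measurable_powR _)).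
  apply: nonincreasing_emeasurable => // x y xy.
  case: dF => F0 Fn.
  by apply: le_poweR; [exact: ltW| |rewrite Fn// ler_pM2l].
- by move=> x _; exact: F_ge0.
- by rewrite lee_fin mulr_ge0 ?powR_ge0// ltW.
Qed.

Lemma lorentz_int_mulc F (c : R) : is_distr F -> (0 <= c)%R ->
  lorentz_int (fun l => c%:E * F l) = (c `^ t)%:E * lorentz_int F.
Proof.
move=> dF c0; rewrite !lorentz_intE.
transitivity (\int[leb]_(l in `]0%R, +oo[)
    ((c `^ t)%:E * ((l `^ (q - 1))%:E * F l `^ t))).
  apply: eq_integral => l _.
  rewrite poweRM ?poweR_EFin; [|by rewrite lee_fin|by case: dF].
  by rewrite muleCA.
apply: ge0_integralZl.
- exact: measurable_itv.
- exact: mF.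
- by move=> l _; exact: F_ge0.
- by rewrite lee_fin powR_ge0.
Qed.

Lemma lorentz_int_indic (m : \bar R) : 0 <= m ->
  lorentz_int (fun l => if (l < 1)%R then m else 0) = (q^-1)%:E * m `^ t.
Proof.
move=> m0; rewrite lorentz_intE.
have mf (D : set R) : measurable_fun D (fun l : R => (q * l `^ (q - 1))%:E).
  apply/measurable_EFinP; apply: measurable_funTS.
  by apply: measurable_funM => //; exact: measurable_powR.
pose c := (q^-1)%:E * m `^ t.
transitivity (\int[leb]_(l in `]0%R, +oo[)
    (((fun l => c * (q * l `^ (q - 1))%:E) \_ `]0%R, 1%R[) l)).
  apply: eq_integral => l; rewrite inE/= in_itv/= andbT => l0.
  rewrite patchE mem_setE in_itv/= l0/=; case: ifPn => l1; last first.
    by rewrite poweR0r ?gt_eqF// mule0.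
  by rewrite /c muleAC -EFinM mulrA mulVf ?gt_eqF// mul1r.
rewrite -integral_mkcondr.
have -> : (`]0%R, +oo[%classic `&` `]0%R, 1%R[%classic = `]0%R, 1%R[%classic :> set R).
  by apply/seteqP; split => l /=; rewrite !in_itv/= ?andbT; [case|move=> /andP[-> ->]].
rewrite integral_itv_bndo_bndc; last first.
  by apply: emeasurable_funM => //; exact: mf.
rewrite ge0_integralZl//.
- by rewrite integral_powR01 ?mule1.
- exact: mf.
- by move=> l _; rewrite lee_fin mulr_ge0 ?powR_ge0// ltW.
- by rewrite mule_ge0 ?poweR_ge0// lee_fin invr_ge0 ltW.
Qed.

(** The weak-type bound, from the part of the integral over l < s, where
    F l >= F s. *)
Lemma lorentz_int_weak F (s : R) : is_distr F -> (0 < s)%R ->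
  (s `^ q / q)%:E * F s `^ t <= lorentz_int F.
Proof.
move=> dF s0.
have -> : lorentz_int F = (s `^ q)%:E * lorentz_int (fun l => F (s * l)%R).
  rewrite lorentz_int_scale// muleA -EFinM powRN mulfV ?mul1e//.
  by rewrite gt_eqF// powR_gt0.
rewrite EFinM -muleA -lorentz_int_indic; last by case: dF.
rewrite lee_pmul2l//; last by rewrite lte_fin powR_gt0.
case: dF => F0 Fn; apply: le_lorentz_int.
- split => [l|x y xy]; first by case: ifP.
  by case: ifPn => [y1|_]; [rewrite (le_lt_trans xy y1)|case: ifP].
- by split => [l|x y xy]; [|apply: Fn; rewrite ler_pM2l].
- by move=> l l0; case: ifPn => // l1; apply: Fn; rewrite ger_pMr// ltW.
Qed.

(** The map a |-> a^t is not subadditive when t > 1; a geometric weight in n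
    makes up for this for every t > 0: if S is the right-hand side then
    a_n <= 2^-(n+1) S^(1/t), and the a_n sum to at most S^(1/t). *)
Lemma poweR_nneseries_le (x : \bar R) (a : nat -> \bar R) : 0 <= x ->
  (forall n, 0 <= a n) -> x <= \sum_(n <oo) a n ->
  x `^ t <= \sum_(n <oo) (((2 ^ n.+1)%:R `^ t)%:E * a n `^ t).
Proof.
move=> x0 a0 xa.
pose b n := ((2 ^ n.+1)%:R `^ t)%:E * a n `^ t.
have b0 n : 0 <= b n by rewrite mule_ge0 ?poweR_ge0// lee_fin powR_ge0.
rewrite -/(b _); under eq_eseriesr do rewrite -/(b _).
set S := \sum_(n <oo) b n.
have S0 : 0 <= S by apply: nneseries_ge0 => n _ _.
have bS n : b n <= S.
  by rewrite /S (@nneseriesD1 _ _ n xpredT)//= leeDl// nneseries_ge0.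
move: S0 bS; case: S => [r|_ _|//]; last by rewrite leey.
rewrite lee_fin => r0 bS.
have ab n : a n <= ((r `^ t^-1) / (2 ^ n.+1)%:R)%:E.
  have := bS n; rewrite /b; have := a0 n; case: (a n) => [y| |]//=.
    rewrite !lee_fin => y0; rewrite -powRM// => yr.
    rewrite ler_pdivlMr ?ltr0n ?expn_gt0// mulrC.
    have : ((((2 ^ n.+1)%:R * y) `^ t) `^ t^-1 <= r `^ t^-1)%R.
      by apply: ge0_ler_powR => //; rewrite ?nnegrE ?powR_ge0 ?invr_ge0 ?(ltW t0).
    by rewrite -powRrM mulfV ?gt_eqF// powRr1// mulr_ge0.
  rewrite (gt_eqF t0) => _.
  by rewrite gt0_muley// lte_fin powR_gt0// ltr0n expn_gt0.
have : x <= (r `^ t^-1)%:E.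
  apply: (le_trans xa); apply: le_trans (epsilon_trick0 xpredT (powR_ge0 r t^-1)).
  by apply: lee_nneseries => n _ //; exact: ab.
move=> /(le_poweR (ltW t0) x0) /le_trans; apply.
by rewrite poweR_EFin -powRrM mulVf ?gt_eqF// powRr1.
Qed.

(** Countable quasi-subadditivity: the weights 2^(n t) replace the constant of
    the quasi-triangle inequality, whose powers would pile up under
    iteration. *)
Lemma lorentz_int_sum F (G : nat -> R -> \bar R) : is_distr F ->
  (forall n, is_distr (G n)) ->
  (forall l, (0 < l)%R -> F l <= \sum_(n <oo) G n l) ->
  lorentz_int F <= \sum_(n <oo) (((2 ^ n.+1)%:R `^ t)%:E * lorentz_int (G n)).
Proof.
move=> dF dG FG; rewrite lorentz_intE.
have mG n : measurable_fun (`]0%R, +oo[%classic : set R) (fun l : R =>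
  ((2 ^ n.+1)%:R `^ t)%:E * ((l `^ (q - 1))%:E * G n l `^ t)).
  by apply: emeasurable_funM => //; exact: mF.
have G0 n (l : R) : 0 <= ((2 ^ n.+1)%:R `^ t)%:E * ((l `^ (q - 1))%:E * G n l `^ t).
  by rewrite mule_ge0// lee_fin powR_ge0.
apply: (@le_trans _ _ (\int[leb]_(l in `]0%R, +oo[)
   \sum_(n <oo) (((2 ^ n.+1)%:R `^ t)%:E * ((l `^ (q - 1))%:E * G n l `^ t)))).
  apply: ge0_le_integral => //.
  - exact: mF.
  - apply: (@ge0_emeasurable_sum _ _ _ _ _ xpredT); last by move=> n _; exact: mG.
    by move=> n l _ _; exact: G0.
  - move=> l /=; rewrite in_itv/= andbT => l0.
    under eq_eseriesr do rewrite muleCA.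
    rewrite nneseriesZl; last by move=> n _; rewrite mule_ge0 ?poweR_ge0// lee_fin powR_ge0.
    rewrite lee_pmul ?poweR_ge0 ?lee_fin ?powR_ge0//.
    by apply: poweR_nneseries_le; [case: dF|move=> n; case: (dG n)|exact: FG].
rewrite integral_nneseries//; apply: lee_nneseries => n _.
  by move=> _; apply: integral_ge0 => l _; exact: G0.
rewrite ge0_integralZl//.
- by rewrite lorentz_intE.
- exact: mF.
Qed.

(** Freezing F below n + 1 amounts to keeping only the values above n + 1 of a
    function with distribution F.  The integrand decreases to 0 by the
    weak-type bound, and dominated convergence applies. *)
Lemma lorentz_int_tail F (e : R) : is_distr F -> lorentz_int F < +oo ->
  (0 < e)%R -> exists n : nat, lorentz_int (fun l => F (Num.max n.+1%:R l)) <= e%:E.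
Proof.
move=> dF JF e0; case: (dF) => F0 Fn.
pose g (l : R) := (l `^ (q - 1))%:E * F l `^ t.
pose f n (l : R) := (l `^ (q - 1))%:E * F (Num.max n.+1%:R l) `^ t.
have dFn n : is_distr (fun l => F (Num.max n.+1%:R l)).
  by split => // x y xy; apply: Fn; rewrite ge_max !le_max xy !lexx !orbT.
have f_ge0 n l : 0 <= f n l by rewrite mule_ge0 ?poweR_ge0// lee_fin powR_ge0.
have fg n l : f n l <= g l.
  rewrite lee_pmul ?poweR_ge0 ?lee_fin ?powR_ge0//; apply: le_poweR => //.
    exact: ltW.
  by apply: Fn; rewrite le_max lexx orbT.
have := JF; rewrite lorentz_intE => Jg.
pose K := fine (lorentz_int F).
have KE : lorentz_int F = K%:E by rewrite fineK// ge0_fin_numE// lorentz_int_ge0.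
have wk n : F n.+1%:R `^ t <= (K * q * (n.+1%:R^-1) `^ q)%:E.
  have n0' : (0 < n.+1%:R :> R)%R by rewrite ltr0n.
  have := lorentz_int_weak dF n0'; rewrite KE => h.
  have nq : (0 < n.+1%:R `^ q / q)%R by rewrite divr_gt0// powR_gt0.
  rewrite -(@lee_pmul2l _ (n.+1%:R `^ q / q)%:E)//; apply: (le_trans h).
  rewrite -EFinM lee_fin le_eqVlt; apply/orP; left; apply/eqP.
  rewrite -(powR_inv1 (ler0n R n.+1)) powRAC powR_inv1 ?powR_ge0//.
  by field; rewrite !gt_eqF// powR_gt0.
have f0 : {ae leb, forall l, `]0%R, +oo[%classic l -> f ^~ l @ \oo --> (cst 0 l : \bar R)}.
  apply/aeW => l; rewrite /= in_itv/= andbT => l0.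
  apply: (@squeeze_cvge _ _ _ _ (cst 0) _ (fun n => (l `^ (q - 1) * (K * q * (n.+1%:R^-1) `^ q))%:E)).
  - near=> n; apply/andP; split; first exact: f_ge0.
    rewrite /f EFinM lee_pmul ?poweR_ge0 ?lee_fin ?powR_ge0//.
    apply: le_trans (wk n).
    by apply: le_poweR => //; [exact: ltW|apply: Fn; rewrite le_max lexx].
  - exact: cvg_cst.
  - apply: cvg_EFin; first by near=> n.
    rewrite -(mulr0 (l `^ (q - 1))%R); apply: cvgM; first exact: cvg_cst.
    rewrite -(mulr0 (K * q)%R); apply: cvgM; first exact: cvg_cst.
    exact: cvg_harmonic_powR.
have ig : leb.-integrable `]0%R, +oo[%classic g.
  apply/integrableP; split; first exact: mF.
  by under eq_integral do rewrite gee0_abs ?F_ge0//.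
have fdom : {ae leb, forall l n, `]0%R, +oo[%classic l -> `|f n l| <= g l}.
  by apply/aeW => l n _; rewrite gee0_abs.
have [_ _] := @dominated_convergence _ _ _ leb `]0%R, +oo[%classic (measurable_itv _)
  f (cst 0) g (fun n => mF (measurable_itv _) (dFn n)) (measurable_cst _) f0 ig fdom.
rewrite integral0 => /(_ _ (open_ereal_lt' (e0 : 0 < e%:E))) [n _ /(_ n)].
by move=> /(_ (leqnn _))/= /ltW fe; exists n; rewrite lorentz_intE.
Unshelve. all: by end_near. Qed.
End LorentzFunctional.

(** * Vitali covering *)

(** Only finitely many disjoint subsets of G have measure above 1 / n. *)
Lemma countable_trivIset_pos d (X : measurableType d) (R : realType)
  (m : {measure set X -> \bar R}) (J : pointedType) (D : set J) (S : J -> set X) (G : set X) :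
  measurable G -> (m G < +oo)%E -> (forall i, D i -> measurable (S i)) ->
  (forall i, D i -> S i `<=` G) -> (forall i, D i -> 0 < m (S i))%E ->
  trivIset D S -> countable D.
Proof.
move=> mG Gfin mS SG S0 tS.
have Sfin i : D i -> m (S i) \is a fin_num.
  move=> Di; rewrite ge0_fin_numE// (le_lt_trans _ Gfin)// le_measure ?inE//.
    exact: mS.
  exact: SG.
rewrite [X in countable X](_ : _ =
    \bigcup_n [set i | D i /\ n.+1%:R^-1 < fine (m (S i))]); last first.
  apply/seteqP; split=> [i Di|i [n _ []]//].
  have /ltr_add_invr[k] : 0 < fine (m (S i)) by rewrite fine_gt0// S0//= -ge0_fin_numE// Sfin.
  by rewrite add0r => ik; exists k.
apply: bigcup_countable => // n _; apply: finite_set_countable.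
apply: contrapT => /infiniteP/pcard_leP/injfunPex[/= q q_fun q_inj].
have Dq k : D (q k) by have [] := q_fun k I.
pose K := (Num.truncn (fine (m G) * n.+1%:R)).+1.
have mq k : measurable (S (q k)) by exact: mS.
have : (m (\bigcup_(k in `I_K) S (q k)) <= m G)%E.
  rewrite le_measure ?inE//.
    by apply: bigcup_measurable => k _.
  by move=> x [k _]; exact: SG.
rewrite measure_fin_bigcup//; last first.
  move=> i j _ _ ij; apply: q_inj; rewrite ?inE//; apply: tS => //.
rewrite leNgt => /negP; apply.
have GE : m G = (fine (m G))%:E by rewrite fineK// ge0_fin_numE.
rewrite GE (_ : fine (m G) = (fine (m G) * n.+1%:R) * n.+1%:R^-1); last by rewrite mulfK.
rewrite (@lt_le_trans _ _ (K%:R * n.+1%:R^-1)%:E)//.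
  by rewrite lte_fin ltr_pM2r ?invr_gt0// truncnS_gt.
rewrite -fsbig_ord/= (_ : K%:R * n.+1%:R^-1 = \sum_(i < K) n.+1%:R^-1); last first.
  by rewrite sumr_const card_ord mulr_natl.
rewrite -sumEFin; apply: lee_sum => i _.
have [_ /ltW] := q_fun i I.
by rewrite -lee_fin fineK// Sfin.
Qed.

Section MetricOuterMeasure.
Context {R : realType} {T : pointedMetricType R}.
Variable mu : {outer_measure set T -> \bar R}.
Hypothesis hreg : borel_regular mu.
Local Notation X := (caratheodory_type mu).
Local Notation M := (mu : set X -> \bar R).
Local Open Scope ereal_scope.

Lemma open_caratheodory (U : set T) : open U -> measurable (U : set X).
Proof. by move=> oU; apply: hreg.1; exact: sub_gen_smallest. Qed.

Lemma open_superlevel_measurable (f : T -> \bar R) :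
  (forall a : R, open [set x | a%:E < f x]) -> mu_measurable mu f.
Proof.
move=> of_ mD; apply: (measurability _ (ErealGenOInfty.measurableE R)) => //.
move=> _ [_ [x ->] <-]; rewrite setTI.
have -> : f @^-1` `]x%:E, +oo[ = [set y | x%:E < f y].
  by apply/seteqP; split => y /=; rewrite in_itv/= andbT.
exact: open_caratheodory.
Qed.

Lemma ball_mdistP (x y : T) (r : R) : ball x r y <-> (mdist x y < r)%R.
Proof. by rewrite ballEmdist. Qed.

Lemma open_metric_ball (x : T) (r : R) : open (ball x r).
Proof.
rewrite openE => y /ball_mdistP yr; apply/nbhs_ballP.
exists (r - mdist x y)%R => /=; first by rewrite subr_gt0.
move=> z /ball_mdistP yz; apply/ball_mdistP; rewrite (le_lt_trans (metric_triangle x y z))//.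
by rewrite -ltrBrDl.
Qed.

Lemma measurable_metric_ball (x : T) (r : R) : measurable (ball x r : set X).
Proof. exact/open_caratheodory/open_metric_ball. Qed.

Definition meets (B B' : T * R) := ball B.1 B.2 `&` ball B'.1 B'.2 !=set0.

(** Zorn's lemma among the disjoint subfamilies D such that every ball of F that
    meets D meets a ball of D of at least half its radius.  If a maximal D
    missed some balls of F, one of almost largest radius among them could be
    added. *)
Lemma vitali_selection (F : set (T * R)) :
  (forall B, F B -> (0 < B.2 <= 1)%R) ->
  exists D : set (T * R), [/\ D `<=` F,
    (forall B B', D B -> D B' -> meets B B' -> B = B') &
    (forall B, F B -> exists B', [/\ D B', meets B B' & (B.2 <= 2 * B'.2)%R])].
Proof.
move=> Fr.
pose P (D : set (T * R)) := [/\ D `<=` F,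
    (forall B B', D B -> D B' -> meets B B' -> B = B') &
    (forall B, F B -> (exists2 B', D B' & meets B B') ->
       exists B', [/\ D B', meets B B' & (B.2 <= 2 * B'.2)%R])].
have [D [[DF Dd Dm] maxD]] : exists D, P D /\ forall D', D `<` D' -> ~ P D'.
  apply: Zorn_bigcup => C CP tC; split.
  - by move=> B [D CD DB]; have [+ _ _] := CP _ CD; exact.
  - move=> B B' [D CD DB] [D' CD' DB'].
    have [DD'|D'D] := tC _ _ CD CD'.
      by have [_ + _] := CP _ CD'; apply => //; exact: DD'.
    by have [_ + _] := CP _ CD; apply => //; exact: D'D.
  - move=> B FB [B' [D CD DB'] BB'].
    have [_ _ h] := CP _ CD.
    have [|B'' [DB'' BB'' r]] := h B FB; first by exists B'.
    by exists B''; split => //; exists D.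
exists D; split => // B FB.
have [|nB] := pselect (exists2 B', D B' & meets B B'); first exact: Dm.
exfalso.
pose F' := [set B | F B /\ ~ exists2 B', D B' & meets B B'].
pose S := [set B.2 | B in F'].
have hS : has_sup S.
  split; first by exists B.2, B.
  by exists 1%R => _ [B' [FB' _] <-]; have /andP[] := Fr _ FB'.
have sS : (0 < sup S)%R.
  have /andP[B0 _] := Fr _ FB.
  by apply: (lt_le_trans B0); apply: ub_le_sup; [exact: hS.2|exists B].
have [_ [B0 [FB0 nB0] <-] B0S] : exists2 r, S r & (sup S - sup S / 2 < r)%R.
  by apply: sup_adherent => //; rewrite divr_gt0.
have self B1 : F B1 -> meets B1 B1.
  by move=> FB1; exists B1.1; split; apply/ball_mdistP; rewrite mdistxx; have /andP[] := Fr _ FB1.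
apply: (maxD (D `|` [set B0])).
  split; first by move=> x Dx; left.
  move=> /(_ B0 (or_intror erefl)) DB0; apply: nB0; exists B0 => //; exact: self.
split.
- by move=> x [/DF//|->].
- move=> B1 B2 [D1|->] [D2|->] // m.
  + exact: Dd.
  + by exfalso; apply: nB0; exists B1 => //; rewrite /meets setIC.
  + by exfalso; apply: nB0; exists B2.
- move=> B1 FB1 [B' DB' BB'].
  have [e|ne] := pselect (exists2 B', D B' & meets B1 B').
    by have [B2 [DB2 ? ?]] := Dm _ FB1 e; exists B2; split => //; left.
  case: DB' => [DB'|B'0]; first by exfalso; apply: ne; exists B'.
  exists B0; split; [by right|by rewrite -B'0|].
  have : (B1.2 <= sup S)%R by apply: ub_le_sup; [exact: hS.2|exists B1].
  lra.
Qed.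

Hypothesis hball : balls_pos_finite mu.
Variable cd : R.
Hypothesis cd0 : (0 < cd)%R.
Hypothesis hcd : forall (x : T) (r : R), (0 < r)%R ->
  mu (ball x (2 * r)%R) <= cd%:E * mu (ball x r).

Lemma doubling3 (x : T) (r : R) : (0 < r)%R ->
  mu (ball x (8 * r)%R) <= (cd ^+ 3)%:E * mu (ball x r).
Proof.
move=> r0; have -> : (8 * r = 2 * (2 * (2 * r)))%R by ring.
have mono_cd : forall a b : \bar R, a <= b -> cd%:E * a <= cd%:E * b.
  by move=> a b ab; rewrite lee_pmul2l.
rewrite !exprS expr0 mulr1 !EFinM -!muleA.
apply: (le_trans (hcd _ _)); first by rewrite !mulr_gt0.
apply: (mono_cd _ _ _); apply: (le_trans (hcd _ _)); first by rewrite !mulr_gt0.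
by apply: (mono_cd _ _ _); exact: hcd.
Qed.

(** If B meets a selected B' with r <= 2 r', then 2 B is contained in 8 B',
    whose measure is at most cd^3 mu B' and thus at most cd^3 / theta times
    mu (G `&` B'); these sets are disjoint. *)
Lemma vitali_measure (F : set (T * R)) (G : set T) (theta : R) :
  (forall B, F B -> (0 < B.2 <= 1)%R) -> measurable (G : set X) ->
  (0 < theta)%R ->
  (forall B, F B -> theta%:E * mu (ball B.1 B.2) <= mu (G `&` ball B.1 B.2)) ->
  mu (\bigcup_(B in F) ball B.1 (2 * B.2)%R) <= (cd ^+ 3 / theta)%:E * mu G.
Proof.
move=> Fr mG th0 FG.
pose C := (cd ^+ 3 / theta)%R.
have C0 : (0 < C)%R by rewrite divr_gt0// exprn_gt0.
have [Gfin|] := ltP (mu G) +oo; last first.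
  by rewrite leye_eq => /eqP ->; rewrite gt0_muley ?leey// lte_fin.
have [D [DF Dd Dcov]] := vitali_selection Fr.
have mB (B : T * R) : measurable (ball B.1 B.2 : set X) by exact: measurable_metric_ball.
have tD : trivIset D (fun B => (G `&` ball B.1 B.2 : set X)).
  move=> B B' DB DB' [x [[_ Bx] [_ B'x]]]; apply: Dd => //; by exists x.
have cD : countable D.
  apply: (@countable_trivIset_pos _ X R M _ D
    (fun B => (G `&` ball B.1 B.2 : set X)) G) => //.
  - by move=> B _; apply: measurableI.
  - by move=> B DB; apply: lt_le_trans (FG _ (DF _ DB)); rewrite mule_gt0// ?lte_fin//;
      have /andP[B0 _] := Fr _ (DF _ DB); have [] := hball B.1 B0.
have /countable_injP[f finj] := cD.
pose A (c : R) k := \bigcup_(B in D `&` f @^-1` [set k]) ball B.1 (c * B.2)%R.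
have AE c k B : D B -> f B = k -> A c k = ball B.1 (c * B.2)%R.
  move=> DB fB; apply/seteqP; split => [x [B' [DB' fB'] B'x]|x Bx].
    have -> : B = B' by apply: finj; rewrite ?inE// fB.
    exact: B'x.
  by exists B.
have A0 c k : (forall B, D B -> f B <> k) -> A c k = set0.
  by move=> nB; apply/seteqP; split => // x [B [DB fB] _]; exfalso; apply: (nB B).
have Ale k : mu (A 8%R k) <= C%:E * mu (G `&` A 1%R k).
  have [[B [DB fB]]|nB] := pselect (exists B, D B /\ f B = k); last first.
    by rewrite A0 ?outer_measure0 ?mule_ge0 ?lee_fin ?(ltW C0)// => B DB fB; apply: nB; exists B.
  rewrite !(AE _ _ B)// mul1r.
  have /andP[r0 _] := Fr _ (DF _ DB).
  apply: (le_trans (doubling3 _ r0)).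
  rewrite (_ : (cd ^+ 3)%:E * _ = C%:E * (theta%:E * mu (ball B.1 B.2))); last first.
    by rewrite muleA -EFinM /C divfK// gt_eqF.
  by rewrite lee_pmul2l//; exact: FG (DF _ DB).
apply: (@le_trans _ _ (mu (\bigcup_k A 8%R k))).
  apply: le_outer_measure => x [B FB Bx].
  have [B' [DB' [y [By B'y]] r]] := Dcov _ FB.
  exists (f B') => //; rewrite (AE _ _ B')//; move/ball_mdistP in Bx; move/ball_mdistP in By.
  move/ball_mdistP in B'y; apply/ball_mdistP.
  have h1 := metric_triangle B'.1 y x.
  have h2 := metric_triangle y B.1 x.
  rewrite (metric_sym y B.1) in h2.
  have /andP[? _] := Fr _ (DF _ DB').
  lra.
apply: (le_trans (outer_measure_sigma_subadditive mu _)).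
apply: (@le_trans _ _ (\sum_(k <oo) (C%:E * mu (G `&` A 1%R k)))).
  by apply: lee_nneseries => k _ //.
rewrite nneseriesZl//; rewrite lee_pmul2l//.
have mA k : measurable (G `&` A 1%R k : set X).
  apply: measurableI => //; apply: open_caratheodory; apply: bigcup_open => B _.
  exact: open_metric_ball.
have := @measure_bigcup _ R X M setT (fun k => G `&` A 1%R k) (fun i _ => mA i).
rewrite (_ : \sum_(i <oo | i \in setT) _ = \sum_(i <oo) mu (G `&` A 1%R i)); last first.
  by apply: eq_eseriesl => i; rewrite in_setT.
move=> <-; first by apply: le_outer_measure => x [k _ []].
move=> i j _ _ [x [[Gx [B [DB fB] Bx]] [_ [B' [DB' fB'] B'x]]]].
rewrite -fB -fB'; congr f; apply: Dd => //.
by exists x; split; [move: Bx; rewrite mul1r|move: B'x; rewrite mul1r].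
Qed.

End MetricOuterMeasure.

(** * Controlled sets *)

Section Bump.
Context {R : realType} {T : pointedMetricType R}.

Definition cutoff (B : T * R) (x : T) : R :=
  Num.max 0 (Num.min 1 (2 - mdist B.1 x / B.2)).

Lemma cutoff_ge0 B x : 0 <= cutoff B x.
Proof. by rewrite le_max lexx. Qed.

Lemma cutoff_le1 B x : cutoff B x <= 1.
Proof. by rewrite ge_max ler01 ge_min lexx. Qed.

Lemma cutoff_eq1 (B : T * R) x : 0 < B.2 -> ball B.1 B.2 x -> cutoff B x = 1.
Proof.
move=> r0 /ball_mdistP Bx; apply/eqP; rewrite eq_le cutoff_le1/= le_max le_min lexx/=.
have : mdist B.1 x / B.2 <= 1 by rewrite ler_pdivrMr// mul1r ltW.
by move=> h; apply/orP; right; lra.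
Qed.

Lemma cutoff_eq0 (B : T * R) x : 0 < B.2 -> 2 * B.2 <= mdist B.1 x -> cutoff B x = 0.
Proof.
move=> r0 Bx; apply/eqP; rewrite eq_le cutoff_ge0 andbT ge_max lexx/= ge_min.
apply/orP; right; rewrite subr_le0 ler_pdivlMr//.
Qed.

Lemma cutoff_lip (B : T * R) x y : 0 < B.2 ->
  cutoff B x <= cutoff B y + mdist x y / B.2.
Proof.
move=> r0.
have D0 : 0 <= mdist x y / B.2 by rewrite divr_ge0 ?mdist_ge0// ltW.
have h : mdist B.1 y / B.2 <= mdist B.1 x / B.2 + mdist x y / B.2.
  by rewrite -mulrDl ler_pM2r ?invr_gt0// metric_triangle.
rewrite {1}/cutoff ge_max addr_ge0 ?cutoff_ge0//=.
have [b1|b1] := leP (mdist B.1 y / B.2) 1.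
  suff -> : cutoff B y = 1 by rewrite ge_min lerDl D0.
  apply/eqP; rewrite eq_le cutoff_le1 le_max le_min lexx/=.
  by apply/orP; right; lra.
rewrite ge_min; apply/orP; right.
have : 2 - mdist B.1 y / B.2 <= cutoff B y.
  by rewrite le_max le_min lexx andbT; apply/orP; right; lra.
lra.
Qed.

(** A function with values in [0, 1] that is Lipschitz with constant 1 / r is
    s-Hoelder with constant r^-s: min(1, t) <= t^s. *)
Lemma cutoff_holder (s : R) (B : T * R) x y : 0 < s <= 1 -> 0 < B.2 ->
  cutoff B x <= cutoff B y + mdist x y `^ s * B.2 `^ (- s).
Proof.
move=> /andP[s0 s1] r0.
rewrite powRN -powR_inv1 ?powR_ge0// powRAC powR_inv1 ?(ltW r0)//.
rewrite -powRM ?mdist_ge0 ?invr_ge0 ?(ltW r0)//.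
have D0 : 0 <= mdist x y / B.2 by rewrite divr_ge0 ?mdist_ge0// ltW.
have [D1|D1] := leP 1 (mdist x y / B.2).
  apply: (le_trans (cutoff_le1 B x)); apply: ler_wpDl; first exact: cutoff_ge0.
  by rewrite -(powRr0 (mdist x y / B.2)) ler_powR// ltW.
apply: (le_trans (cutoff_lip x y r0)); rewrite lerD2l.
have [->|Dn0] := eqVneq (mdist x y / B.2) 0; first exact: powR_ge0.
by rewrite ger1_powR// (ltW D1) andbT lt_neqAle eq_sym Dn0.
Qed.

Lemma open_cutoff_gt (B : T * R) (a : R) : 0 < B.2 -> open [set x | a < cutoff B x].
Proof.
move=> r0; rewrite openE => x /= ax; apply/nbhs_ballP.
exists (B.2 * (cutoff B x - a)) => /=; first by rewrite mulr_gt0// subr_gt0.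
move=> y /ball_mdistP xy /=; have := cutoff_lip x y r0.
suff : mdist x y / B.2 < cutoff B x - a by lra.
by rewrite ltr_pdivrMr// mulrC.
Qed.

End Bump.

Section Controlled.
Context {R : realType} {T : pointedMetricType R}.
Variable mu : {outer_measure set T -> \bar R}.
Variable s : R.
Hypothesis hs : (0 < s <= 1)%R.
Local Open Scope ereal_scope.
Implicit Types (v h : T -> \bar R) (A N : set T).

(** One-sided Hoelder bounds suffice, as x and y may be exchanged; they avoid
    subtraction in [\bar R]. *)
Definition ctrl v N A h := [/\ mu_measurable mu v,
  (forall x, 0 <= v x <= 1), (forall x, A x -> v x = 1), mu N = 0 &
  (forall x, ~ N x -> v x <= h x) /\
  (forall x y, ~ N x -> ~ N y ->
    v x <= v y + (mdist x y `^ s)%:E * (h x + h y))].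

Definition controlled A h := exists v N, ctrl v N A h.

Definition supn (h : nat -> T -> \bar R) (x : T) : \bar R :=
  ereal_sup (range (h ^~ x)).

Lemma supn_ge (H : nat -> T -> \bar R) n x : H n x <= supn H x.
Proof. by apply: ereal_sup_ubound; exists n. Qed.

Lemma supn_le (H : nat -> T -> \bar R) x a : (forall n, H n x <= a) -> supn H x <= a.
Proof. by move=> ha; apply: ge_ereal_sup => _ [n _ <-]. Qed.

Lemma measurable_supn (H : nat -> T -> \bar R) :
  (forall n, mu_measurable mu (H n)) -> mu_measurable mu (supn H).
Proof.
move=> mH; rewrite /mu_measurable (_ : supn H = fun x => esups (H ^~ x) 0%N).
  exact: measurable_fun_esups.
apply/funext => x; rewrite /supn /esups; congr ereal_sup.
by apply/seteqP; split => [_ [n _ <-]|_ [n _ <-]]; exists n.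
Qed.

Lemma outer_measure_null_bigcup (N : nat -> set T) :
  (forall n, mu (N n) = 0) -> mu (\bigcup_n N n) = 0.
Proof.
move=> N0; apply/eqP; rewrite eq_le outer_measure_ge0 andbT.
apply: (le_trans (outer_measure_sigma_subadditive mu _)).
by rewrite eseries0// => n _ _; rewrite N0.
Qed.

Lemma controlled_bigcup (A : nat -> set T) (h : nat -> T -> \bar R) :
  (forall n x, 0 <= h n x) -> (forall n, controlled (A n) (h n)) ->
  controlled (\bigcup_n A n) (supn h).
Proof.
move=> h0 /choice[v /choice[N cv]].
have vle1 n x : v n x <= 1 by have [_ /(_ x)/andP[]] := cv n.
have vge0 n x : 0 <= v n x by have [_ /(_ x)/andP[]] := cv n.
exists (supn v), (\bigcup_n N n); split.
- by apply: measurable_supn => n; have [] := cv n.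
- move=> x; rewrite (le_trans (vge0 0%N x) (supn_ge _ _ _))/=.
  by apply: supn_le => n; exact: vle1.
- move=> x [n _ Ax]; apply/eqP; rewrite eq_le; apply/andP; split.
    by apply: supn_le => m; exact: vle1.
  by have [_ _ /(_ _ Ax) <- _ _] := cv n; exact: supn_ge.
- by apply: outer_measure_null_bigcup => n; have [] := cv n.
- split=> [x Nx|x y Nx Ny].
    apply: supn_le => n; have [_ _ _ _ [vh _]] := cv n.
    apply: le_trans (supn_ge h n x).
    by apply: vh => Nnx; apply: Nx; exists n.
  apply: supn_le => n; have [_ _ _ _ [_ vd]] := cv n.
  have Nnx : ~ N n x by move=> Nnx; apply: Nx; exists n.
  have Nny : ~ N n y by move=> Nny; apply: Ny; exists n.
  apply: (le_trans (vd _ _ Nnx Nny)).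
  apply: leeD; first exact: supn_ge.
  by rewrite lee_wpmul2l ?lee_fin ?powR_ge0// leeD// supn_ge.
Qed.

Hypothesis hreg : borel_regular mu.

(** The witness is max(v, sup of the cutoffs of the balls).  The cutoff of a ball
    B matters only in 2 B and where v < 1, and there h exceeds its Hoelder
    constant. *)
Lemma ctrl_bump v N A h (F : set (T * R)) : ctrl v N A h ->
  (forall x, 0 <= h x) ->
  (forall B, F B -> (0 < B.2 <= 1)%R) ->
  (forall B x, F B -> ~ N x -> (mdist B.1 x < 2 * B.2)%R -> v x < 1 ->
     (B.2 `^ (- s))%:E <= h x) ->
  controlled (A `|` \bigcup_(B in F) ball B.1 B.2) h.
Proof.
move=> [mv v01 vA N0 [vh vd]] h0 Fr Fh.
(* Open superlevel sets make the uncountable supremum measurable. *)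
pose b x := ereal_sup [set (cutoff B x)%:E | B in F].
have b1 x : b x <= 1 by apply: ge_ereal_sup => _ [B _ <-]; rewrite lee_fin cutoff_le1.
have v1 x : v x <= 1 by have /andP[] := v01 x.
have mb : mu_measurable mu b.
  apply: open_superlevel_measurable => // a.
  rewrite (_ : [set x | _] = \bigcup_(B in F) [set x | (a < cutoff B x)%R]).
    by apply: bigcup_open => B FB; apply: open_cutoff_gt; have /andP[] := Fr _ FB.
  apply/seteqP; split => [x /ereal_sup_gt[_ [B FB <-]]|x [B FB]] /=.
    by rewrite lte_fin => aB; exists B.
  by rewrite -lte_fin => /lt_le_trans; apply; apply: ereal_sup_ubound; exists B.
pose w x := maxe (v x) (b x).
exists w, N; split.
- exact: measurable_maxe.
- by move=> x; rewrite le_max ge_max v1 b1; have /andP[->] := v01 x.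
- move=> x Ax; apply/eqP; rewrite eq_le ge_max v1 b1/= le_max.
  case: Ax => [/vA ->|[B FB Bx]]; first by rewrite lexx.
  apply/orP; right; rewrite -(cutoff_eq1 _ Bx); last by have /andP[] := Fr _ FB.
  by apply: ereal_sup_ubound; exists B.
- exact: N0.
have key B x : F B -> ~ N x -> [\/ v x = 1, cutoff B x = 0%R | (B.2 `^ (- s))%:E <= h x].
  move=> FB Nx; have [vx1|vx1] := eqVneq (v x) 1; first exact: Or31.
  have /andP[r0 _] := Fr _ FB.
  have [xB|xB] := leP (2 * B.2)%R (mdist B.1 x); first by apply: Or32; exact: cutoff_eq0.
  by apply: Or33; apply: Fh => //; rewrite lt_neqAle vx1 v1.
have r1 B : F B -> (1 <= B.2 `^ (- s))%R.
  move=> /Fr /andP[r0 r1]; rewrite powRN invf_ge1 ?powR_gt0//.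
  have : (B.2 `^ s <= 1 `^ s)%R.
    apply: ge0_ler_powR; rewrite ?nnegrE ?ler01 ?(ltW r0)//.
    by have /andP[/ltW] := hs.
  by rewrite powR1.
split.
- move=> x Nx; rewrite ge_max vh//=; apply: ge_ereal_sup => _ [B FB <-].
  have [vx1|->|hx] := key B x FB Nx.
  + by apply: le_trans (vh _ Nx); rewrite vx1 lee_fin cutoff_le1.
  + exact: h0.
  + by apply: le_trans hx; rewrite lee_fin (le_trans (cutoff_le1 _ _))// r1.
- move=> x y Nx Ny.
  have D0 : 0 <= (mdist x y `^ s)%:E * (h x + h y).
    by rewrite mule_ge0 ?lee_fin ?powR_ge0// adde_ge0.
  have wy0 : 0 <= w y by rewrite le_max; have /andP[->] := v01 y.
  have vxw : v x <= w y + (mdist x y `^ s)%:E * (h x + h y).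
    by apply: le_trans (vd _ _ Nx Ny) _; rewrite leeD2r// le_max lexx.
  rewrite ge_max vxw/=; apply: ge_ereal_sup => _ [B FB <-].
  have [vx1|->|hx] := key B x FB Nx.
  + by apply: le_trans vxw; rewrite vx1 lee_fin cutoff_le1.
  + by rewrite adde_ge0.
  + have /andP[r0 _] := Fr _ FB.
    have := cutoff_holder x y hs r0; rewrite -lee_fin => /le_trans; apply.
    rewrite EFinD EFinM; apply: leeD.
      by rewrite le_max; apply/orP; right; apply: ereal_sup_ubound; exists B.
    rewrite lee_wpmul2l ?lee_fin ?powR_ge0//.
    by apply: (le_trans hx); rewrite leeDl.
Qed.

End Controlled.

(** * Polar sets and capacity *)

Lemma unit_trunc_lip {R : realFieldType} (a b d : R) : `|a - b| <= d ->
  Num.min 1 (Num.max 0 a) <= Num.min 1 (Num.max 0 b) + d.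
Proof.
move=> abd; have d0 : 0 <= d by exact: le_trans abd.
rewrite -lerBlDr le_min; apply/andP; split.
  by rewrite lerBlDr ge_min lerDl d0.
move: abd; rewrite ler_norml => /andP[abd1 abd2].
rewrite le_max; apply/orP; have [a0|a0] := leP 0 a; [right|left].
  rewrite lerBlDr ge_min; apply/orP; right; lra.
by rewrite lerBlDr ge_min; apply/orP; right; rewrite add0r.
Qed.

Section Polar.
Context {R : realType} {T : pointedMetricType R}.
Variable mu : {outer_measure set T -> \bar R}.
Variables s p q : R.
Hypotheses (p0 : (0 < p)%R) (q0 : (0 < q)%R).
Local Open Scope ereal_scope.
Implicit Types (v h g : T -> \bar R) (A N Z : set T).

Definition distr h (l : R) : \bar R := mu [set x | l%:E < `|h x|].

Definition lorentz_pow h : \bar R := lorentz_int p q (distr h).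

Lemma lorentz_normE h : lorentz_norm mu p q h = lorentz_pow h `^ q^-1.
Proof. by []. Qed.

Lemma is_distr_distr h : is_distr (distr h).
Proof.
split=> [l|x y xy]; first exact: outer_measure_ge0.
by apply: le_outer_measure => z /=; apply: le_lt_trans; rewrite lee_fin.
Qed.
Local Hint Resolve is_distr_distr : core.

Lemma lorentz_pow_ge0 h : 0 <= lorentz_pow h.
Proof. exact: lorentz_int_ge0. Qed.
Local Hint Resolve lorentz_pow_ge0 : core.

Lemma lorentz_powE h : lorentz_pow h = lorentz_norm mu p q h `^ q.
Proof. by rewrite lorentz_normE -poweRrM mulVf ?poweRe1// gt_eqF. Qed.

Lemma lorentz_norm_lty h : (lorentz_norm mu p q h < +oo) = (lorentz_pow h < +oo).
Proof.
rewrite lorentz_normE; apply/idP/idP; last exact: poweR_lty.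
by apply: lty_poweRy; rewrite invr_eq0 gt_eqF.
Qed.

Lemma distr_ae_le g h N : mu N = 0 -> (forall x, ~ N x -> `|g x| <= `|h x|) ->
  forall l, distr g l <= distr h l.
Proof.
move=> N0 gh l; apply: (@le_trans _ _ (mu ([set x | l%:E < `|h x|] `|` N))).
  apply: le_outer_measure => x /= lx; have [|Nx] := pselect (N x); first by right.
  by left => /=; exact: lt_le_trans (gh _ Nx).
by apply: (le_trans (outer_measureU2 _ _ _)); rewrite N0 adde0.
Qed.

Lemma distr_supn (H : nat -> T -> \bar R) l : (forall n x, 0 <= H n x) ->
  distr (supn H) l <= \sum_(n <oo) distr (H n) l.
Proof.
move=> H0; apply: le_trans (outer_measure_sigma_subadditive mu _).
apply: le_outer_measure => x /=; rewrite gee0_abs; last first.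
  exact: le_trans (H0 0%N x) (supn_ge _ _ _).
move=> /ereal_sup_gt[_ [n _ <-]] ln; exists n => //=.
by rewrite gee0_abs.
Qed.

Lemma lorentz_pow_supn (H : nat -> T -> \bar R) : (forall n x, 0 <= H n x) ->
  lorentz_pow (supn H) <=
    \sum_(n <oo) (((2 ^ n.+1)%:R `^ (q / p))%:E * lorentz_pow (H n)).
Proof. by move=> H0; apply: lorentz_int_sum => // l _; exact: distr_supn. Qed.

Definition gradable h := mu_measurable mu h /\ (forall x, 0 <= h x).

Lemma gradable_supn (H : nat -> T -> \bar R) :
  (forall n, gradable (H n)) -> gradable (supn H).
Proof.
move=> mH; split; first by apply: measurable_supn => n; have [] := mH n.
by move=> x; apply: le_trans (supn_ge H 0%N x); have [_] := mH 0%N.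
Qed.

(** A stand-in for capacity zero: the q-th power of the norm, unlike the capacity,
    is tied to one function h, and h is passed from covering argument to covering
    argument. *)
Definition polar Z := forall e : R, (0 < e)%R -> exists U h,
  [/\ open U, Z `<=` U, controlled mu s U h, gradable h & lorentz_pow h <= e%:E].

Lemma sub_polar Z Z' : Z' `<=` Z -> polar Z -> polar Z'.
Proof.
move=> ZZ' pZ e e0; have [U [h [? ZU ? ? ?]]] := pZ e e0.
by exists U, h; split => //; exact: subset_trans ZU.
Qed.

Lemma controlled_sub A A' h : A' `<=` A -> controlled mu s A h -> controlled mu s A' h.
Proof.
move=> AA' [v [N [mv v01 vA N0 vd]]]; exists v, N; split => // x Ax.
by apply: vA; exact: AA'.
Qed.

Lemma lorentz_pow_supn_small (H : nat -> T -> \bar R) (e : R) : (0 <= e)%R ->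
  (forall n x, 0 <= H n x) ->
  (forall n, lorentz_pow (H n) <=
     (e / (2 ^ n.+1)%:R / (2 ^ n.+1)%:R `^ (q / p))%:E) ->
  lorentz_pow (supn H) <= e%:E.
Proof.
move=> e0 H0 He; apply: (le_trans (lorentz_pow_supn H0)).
apply: le_trans (epsilon_trick0 xpredT e0); apply: lee_nneseries => n _ //.
  by move=> _; rewrite mule_ge0// lee_fin powR_ge0.
have c0 : (0 < (2 ^ n.+1)%:R `^ (q / p) :> R)%R by rewrite powR_gt0// ltr0n expn_gt0.
apply: (@le_trans _ _ (((2 ^ n.+1)%:R `^ (q / p))%:E *
   (e / (2 ^ n.+1)%:R / (2 ^ n.+1)%:R `^ (q / p))%:E)).
  by rewrite lee_wpmul2l// lee_fin ltW.
by rewrite -EFinM mulrCA mulfV ?mulr1// gt_eqF.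
Qed.

Lemma polar_bigcup (Z : nat -> set T) : (forall n, polar (Z n)) -> polar (\bigcup_n Z n).
Proof.
move=> pZ e e0.
have c0 n : (0 < e / (2 ^ n.+1)%:R / (2 ^ n.+1)%:R `^ (q / p))%R.
  by rewrite !divr_gt0// ?powR_gt0// ltr0n expn_gt0.
have /choice[U /choice[h Uh]] := fun n => pZ n _ (c0 n).
have h0 n x : 0 <= h n x by have [_ _ _ [_ ]] := Uh n.
exists (\bigcup_n U n), (supn h); split.
- by apply: bigcup_open => n _; have [] := Uh n.
- by move=> x [n _ Zx]; exists n => //; have [_ + _ _ _] := Uh n; exact.
- by apply: controlled_bigcup => // n; have [] := Uh n.
- by apply: gradable_supn => n; have [] := Uh n.
- by apply: lorentz_pow_supn_small => //; [exact: ltW|move=> n; have [] := Uh n].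
Qed.

Lemma polarU Z Z' : polar Z -> polar Z' -> polar (Z `|` Z').
Proof.
move=> pZ pZ'; have : polar (\bigcup_n (if n is 0%N then Z else Z')).
  by apply: polar_bigcup => -[|n].
by apply: sub_polar => x [Zx|Zx]; [exists 0%N|exists 1%N].
Qed.

Lemma lorentz_pow0 : lorentz_pow (cst 0) = 0.
Proof.
rewrite /lorentz_pow /lorentz_int integral0_eq// => l /=; rewrite in_itv/= andbT => l0.
rewrite /distr (_ : [set x | _] = set0) ?outer_measure0 ?poweR0r ?mule0 ?mul0e//.
  by rewrite gt_eqF// divr_gt0.
by rewrite -subset0 => x /=; rewrite normr0 lte_fin ltNge (ltW l0).
Qed.

(** A finite maximum is a supremum of a sequence padded with 0, so that the
    statements on countable suprema cover it. *)
Definition pair_seq h g (n : nat) : T -> \bar R :=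
  if n is 0%N then h else if n is 1%N then g else cst 0.

Lemma supn_pairl h g x : h x <= supn (pair_seq h g) x.
Proof. exact: (supn_ge (pair_seq h g) 0%N x). Qed.

Lemma supn_pairr h g x : g x <= supn (pair_seq h g) x.
Proof. exact: (supn_ge (pair_seq h g) 1%N x). Qed.

Lemma gradable_pair h g : gradable h -> gradable g -> gradable (supn (pair_seq h g)).
Proof.
move=> gh gg; apply: gradable_supn => -[|[|n]] //; split => //.
exact: measurable_cst.
Qed.

Lemma lorentz_pow_pair h g : (forall x, 0 <= h x) -> (forall x, 0 <= g x) ->
  lorentz_pow (supn (pair_seq h g)) <=
    (4 `^ (q / p))%:E * (lorentz_pow h + lorentz_pow g).
Proof.
move=> h0 g0; apply: (le_trans (lorentz_pow_supn _)); first by case=> [|[|n]].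
rewrite (nneseries_split _ 2); last first.
  by move=> n _; rewrite mule_ge0// lee_fin powR_ge0.
rewrite [X in _ + X]eseries0 ?adde0; last first.
  by move=> [|[|n]]// _ _; rewrite /= lorentz_pow0 mule0.
rewrite big_mkord !big_ord_recl big_ord0 adde0 (ge0_muleDr _ (lorentz_pow_ge0 h) (lorentz_pow_ge0 g)).
apply: leeD; rewrite lee_wpmul2r// lee_fin.
  apply: ge0_ler_powR; rewrite ?nnegrE ?divr_ge0 ?(ltW q0) ?(ltW p0)//.
  by rewrite ler_nat.
Qed.

Lemma controlled_set0 : controlled mu s set0 (cst 0).
Proof.
exists (cst 0), set0; split => //.
- exact: measurable_cst.
- by move=> x; rewrite lexx lee01.
- by split => // x y _ _; rewrite /cst add0e adde0 mule0.
Qed.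

Lemma controlled_pair A B h g : (forall x, 0 <= h x) -> (forall x, 0 <= g x) ->
  controlled mu s A h -> controlled mu s B g ->
  controlled mu s (A `|` B) (supn (pair_seq h g)).
Proof.
move=> h0 g0 cA cB.
have : controlled mu s (\bigcup_n (if n is 0%N then A else if n is 1%N then B else set0))
    (supn (pair_seq h g)).
  apply: controlled_bigcup => -[|[|n]]//; exact: controlled_set0.
by apply: controlled_sub => x [Ax|Bx]; [exists 0%N|exists 1%N].
Qed.

Lemma lorentz_pow_scale h (a : R) : (0 < a)%R ->
  lorentz_pow (fun x => a%:E * h x) = (a `^ q)%:E * lorentz_pow h.
Proof.
move=> a0; rewrite /lorentz_pow.
have -> : distr (fun x => a%:E * h x) = fun l => distr h (a^-1 * l)%R.
  apply/funext => l; rewrite /distr; congr (mu _); apply/seteqP.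
  have E x : (l%:E < `|a%:E * h x|) = ((a^-1 * l)%:E < `|h x|).
    rewrite abseM gee0_abs ?lee_fin ?ltW// EFinM.
    by rewrite lte_pdivrMl.
  by split => x /=; rewrite E.
by rewrite lorentz_int_scale ?invr_gt0// powRN -powR_inv1 ?powR_ge0// powRAC
  powR_inv1 ?invr_ge0 ?ltW// invrK.
Qed.

(** The witness is the truncation min(1, max(0, u)) of an admissible function u,
    controlled by max(|u|, g) for a gradient g of u. *)
Lemma capacity_lt_controlled A (e : R) :
  capacity mu (lorentz_norm mu p q) s A < e%:E ->
  exists U h, [/\ open U, A `<=` U, controlled mu s U h, gradable h &
    lorentz_pow h <= (4 `^ (q / p) * (e `^ q + e `^ q))%:E].
Proof.
move=> /ereal_inf_lt[_ [u [[[uL0 _] _] [U [oU AU Uu]]] <-]].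
rewrite /hajlasz_norm => ue.
have nu0 : 0 <= lorentz_norm mu p q u by rewrite lorentz_normE poweR_ge0.
have hom0 : 0 <= hajlasz_hom_norm mu (lorentz_norm mu p q) s u.
  by apply: le_ereal_inf_tmp => _ [g _ <-]; rewrite lorentz_normE poweR_ge0.
have u_e : lorentz_norm mu p q u < e%:E by apply: le_lt_trans ue; rewrite leeDl.
have : hajlasz_hom_norm mu (lorentz_norm mu p q) s u < e%:E.
  by apply: le_lt_trans ue; rewrite leeDr.
move=> /ereal_inf_lt[_ [g [mg g0 [N N0 Nug]] <-]] g_e.
have powe f : lorentz_norm mu p q f < e%:E -> lorentz_pow f <= (e `^ q)%:E.
  move=> /ltW fe; rewrite lorentz_powE -poweR_EFin; apply: le_poweR => //.
    exact: ltW.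
  by rewrite lorentz_normE poweR_ge0.
pose v x := mine 1 (maxe 0 (u x)).
pose N' := N `|` [set x | `|u x| = +oo].
have N'0 : mu N' = 0.
  apply/eqP; rewrite eq_le outer_measure_ge0 andbT.
  by apply: (le_trans (outer_measureU2 _ _ _)); rewrite N0 uL0.2 adde0.
have au0 x : 0 <= `|u x| by exact: abse_ge0.
exists U, (supn (pair_seq (fun x => `|u x|) g)); split => //.
- exists v, N'; split => //.
  + apply: measurable_mine; first exact: measurable_cst.
    by apply: measurable_maxe; [exact: measurable_cst|exact: uL0.1].
  + by move=> x; rewrite /v le_min ge_min lexx lee01 le_max lexx.
  + by move=> x /Uu u1; rewrite /v; apply/min_idPl; rewrite le_max u1 orbT.
  + split=> [x Nx|x y Nx Ny].
      apply: le_trans (supn_pairl _ _ _); rewrite /v ge_min ge_max abse_ge0 lee_abs.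
      by rewrite orbT.
    have ufin z : ~ N' z -> u z \is a fin_num.
      move=> Nz; rewrite fin_num_abs ltey; apply/eqP => uz; apply: Nz; by right.
    have [a ax] : exists a, u x = a%:E by exists (fine (u x)); rewrite fineK// ufin.
    have [b bx] : exists b, u y = b%:E by exists (fine (u y)); rewrite fineK// ufin.
    have Nx' : ~ N x by move=> ?; apply: Nx; left.
    have Ny' : ~ N y by move=> ?; apply: Ny; left.
    have := Nug x y Nx' Ny' => ug.
    have {ug} : `|u x - u y| <= (mdist x y `^ s)%:E *
       (supn (pair_seq (fun x => `|u x|) g) x + supn (pair_seq (fun x => `|u x|) g) y).
      apply: (le_trans ug); rewrite lee_wpmul2l ?lee_fin ?powR_ge0//.
      by apply: leeD; exact: supn_pairr.
    rewrite /v ax bx; set D := ((_ `^ s)%:E * _).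
    case: D => [d| |//]; last by rewrite addey ?leey// -EFin_max -EFin_min.
    rewrite -EFinB -!EFin_max -!EFin_min -EFinD !lee_fin.
    exact: unit_trunc_lip.
- by apply: gradable_pair => //; split => //; apply: measurableT_comp => //; exact: uL0.1.
- apply: (le_trans (lorentz_pow_pair _ _)) => //.
  rewrite EFinM lee_wpmul2l ?lee_fin ?powR_ge0// EFinD; apply: leeD; last exact: powe.
  rewrite (_ : lorentz_pow _ = lorentz_pow u); first exact: powe.
  rewrite /lorentz_pow; congr lorentz_int; apply/funext => l.
  by rewrite /distr; congr (mu _); apply/seteqP; split => x /=; rewrite abse_id.
Qed.

(** The weak-type bound at level l gives mu{|h| = oo}^(q/p) = O(l^-q). *)
Lemma gradable_lorentz_L0 h : gradable h -> lorentz_pow h < +oo ->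
  mu [set x | `|h x| = +oo] = 0.
Proof.
move=> [mh h0] hfin; set S := [set x | _].
have [K KE] : exists K, lorentz_pow h = K%:E.
  by exists (fine (lorentz_pow h)); rewrite fineK// ge0_fin_numE.
have t0 : (0 < q / p)%R by rewrite divr_gt0.
have wk (l : R) : (0 < l)%R -> (l `^ q / q)%:E * mu S `^ (q / p) <= K%:E.
  move=> l0; rewrite -KE; apply: le_trans (lorentz_int_weak p0 q0 (is_distr_distr h) l0).
  rewrite lee_wpmul2l ?lee_fin ?divr_ge0 ?powR_ge0 ?(ltW q0)//.
  apply: le_poweR; [exact: ltW|exact: outer_measure_ge0|].
  by apply: le_outer_measure => x /= ->; rewrite ltey.
apply/eqP; rewrite eq_le outer_measure_ge0 andbT leNgt; apply/negP => S0.
have K0 : (0 <= K)%R by rewrite -lee_fin -KE.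
have := poweR_gt0 (q / p) S0.
case E : (mu S `^ (q / p)) => [m| |//]; last first.
  by have := wk 1%R ltr01; rewrite E gt0_muley// lte_fin divr_gt0// powR_gt0.
rewrite lte_fin => m0.
pose l := (((K + 1) * q / m) `^ q^-1)%R.
have l0 : (0 < l)%R by rewrite powR_gt0// divr_gt0// mulr_gt0// ltr_wpDl.
have := wk l l0; rewrite E -EFinM lee_fin /l -powRrM mulVf ?gt_eqF// powRr1; last first.
  by rewrite divr_ge0 ?(ltW m0)// mulr_ge0 ?(ltW q0)// addr_ge0.
have -> : ((K + 1) * q / m / q * m = K + 1)%R by field; rewrite !gt_eqF.
by rewrite gerDl ler10.
Qed.

(** The witness v of the control is admissible for the capacity: h dominates v
    and is an s-gradient of v. *)
Lemma controlled_capacity U h A (e : R) : open U -> A `<=` U -> (0 <= e)%R ->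
  controlled mu s U h -> gradable h -> lorentz_pow h <= e%:E ->
  capacity mu (lorentz_norm mu p q) s A <= (e `^ q^-1 + e `^ q^-1)%:E.
Proof.
move=> oU AU e0 [v [N [mv v01 vU N0 [vh vd]]]] [mh h0] he.
have hfin : lorentz_pow h < +oo by apply: le_lt_trans he _; rewrite ltry.
have vfin x : v x \is a fin_num.
  by have /andP[v0 v1] := v01 x; rewrite ge0_fin_numE// (le_lt_trans v1)// ltry.
have Gv : sgradient mu s v h.
  split => //; exists N => // x y Nx Ny.
  have h1 := vd x y Nx Ny; have h2 := vd y x Ny Nx.
  rewrite (metric_sym y) (addeC (h y)) in h2.
  move: h1 h2; set D := (_ * _).
  have [a ->] : exists a, v x = a%:E by exists (fine (v x)); rewrite fineK.
  have [b ->] : exists b, v y = b%:E by exists (fine (v y)); rewrite fineK.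
  case: D => [d| |]; [|by move=> _ _; exact: leey|by rewrite addeNy leeNy_eq].
  by rewrite -!EFinD !lee_fin => h1 h2; rewrite ler_norml; apply/andP; split; lra.
have normh : lorentz_norm mu p q h <= (e `^ q^-1)%:E.
  by rewrite lorentz_normE -poweR_EFin; apply: le_poweR => //; rewrite invr_ge0 ltW.
have normv : lorentz_norm mu p q v <= (e `^ q^-1)%:E.
  apply: le_trans normh; rewrite !lorentz_normE; apply: le_poweR => //.
    by rewrite invr_ge0 ltW.
  apply: le_lorentz_int => // l _; apply: (distr_ae_le N0) => x Nx.
  by rewrite !gee0_abs ?vh//; have /andP[] := v01 x.
have homv : hajlasz_hom_norm mu (lorentz_norm mu p q) s v <= (e `^ q^-1)%:E.
  by apply: le_trans normh; apply: ereal_inf_lbound; exists h.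
apply: (@le_trans _ _ (hajlasz_norm mu (lorentz_norm mu p q) s v)); last first.
  by rewrite EFinD; exact: leeD.
apply: ereal_inf_lbound; exists v => //; split.
  split; last by rewrite (le_lt_trans normv)// ltry.
  split; last by rewrite (le_lt_trans homv)// ltry.
  split => //; rewrite (_ : [set x | _] = set0) ?outer_measure0//.
  by rewrite -subset0 => x /= vx; have := vfin x; rewrite fin_num_abs vx.
by exists U; split => // x /vU ->.
Qed.

Lemma polar_capacity Z : polar Z -> capacity mu (lorentz_norm mu p q) s Z = 0.
Proof.
move=> pZ; apply/eqP; rewrite eq_le; apply/andP; split; last first.
  apply: le_ereal_inf_tmp => _ [u _ <-]; apply: adde_ge0.
    by rewrite lorentz_normE poweR_ge0.
  by apply: le_ereal_inf_tmp => _ [g _ <-]; rewrite lorentz_normE poweR_ge0.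
apply/lee_addgt0Pr => e e0; rewrite add0e.
have e2 : (0 < (e / 2) `^ q)%R by rewrite powR_gt0// divr_gt0.
have [U [h [oU ZU cU gh hle]]] := pZ _ e2.
apply: (le_trans (controlled_capacity oU ZU (ltW e2) cU gh hle)).
by rewrite -powRrM mulfV ?gt_eqF// powRr1 ?divr_ge0 ?(ltW e0)// -splitr.
Qed.

End Polar.

(** * Families of balls carrying a large function or a controlled set *)

Section BadBalls.
Context {R : realType} {T : pointedMetricType R}.
Variable mu : {outer_measure set T -> \bar R}.
Variables s p q : R.
Hypothesis hs : (0 < s <= 1)%R.
Hypotheses (p0 : (0 < p)%R) (q0 : (0 < q)%R).
Hypothesis hreg : borel_regular mu.
Hypothesis hball : balls_pos_finite mu.
Variable cd : R.
Hypothesis cd0 : (0 < cd)%R.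
Hypothesis hcd : forall (x : T) (r : R), (0 < r)%R ->
  (mu (ball x (2 * r)%R) <= cd%:E * mu (ball x r))%E.
Local Notation X := (caratheodory_type mu).
Local Open Scope ereal_scope.
Implicit Types (v h g : T -> \bar R) (A N Z : set T) (F : set (T * R)).
Local Notation lpow := (lorentz_pow mu p q).

Lemma measurable_superlevel g (a : \bar R) : mu_measurable mu g ->
  measurable ([set x | a < g x] : set X).
Proof.
move=> mg; have := emeasurable_fun_o_infty (measurableT : measurable (setT : set X)) mg a.
by rewrite setTI.
Qed.

(** The function h = sup r^-s 1_{B(z,2r)} satisfies the hypothesis of
    [ctrl_bump] with v = 0.  Its superlevel set {h > l} is the union of the 2 B
    with r^-s > l; in each such B, g exceeds eta r^-s > eta l on a proportion
    theta, so [vitali_measure] bounds mu{h > l} by (cd^3 / theta) mu{g > eta l}. *)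
Lemma controlled_dense_balls g F (eta theta : R) : gradable mu g ->
  (0 < eta)%R -> (0 < theta)%R ->
  (forall B, F B -> (0 < B.2 <= 1)%R) ->
  (forall B, F B -> theta%:E * mu (ball B.1 B.2) <=
     mu ([set x | (eta * B.2 `^ (- s))%:E < g x] `&` ball B.1 B.2)) ->
  exists h, [/\ controlled mu s (\bigcup_(B in F) ball B.1 B.2) h, gradable mu h &
    lpow h <= ((cd ^+ 3 / theta) `^ (q / p) * eta `^ (- q))%:E * lpow g].
Proof.
move=> [mg g0] eta0 th0 Fr Fg.
(* The maximum with 0 is there for an empty set of balls, whose supremum is -oo. *)
pose h x : \bar R := maxe 0 (ereal_sup
  [set (B.2 `^ (- s))%:E | B in F `&` [set B | (mdist B.1 x < 2 * B.2)%R]]).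
have hE (a : R) : (0 <= a)%R -> [set x | a%:E < h x] =
    \bigcup_(B in F `&` [set B | (a < B.2 `^ (- s))%R]) ball B.1 (2 * B.2)%R.
  move=> a0; apply/seteqP; split => x /=.
    rewrite /h lt_max => /orP[|/ereal_sup_gt[_ [B [FB xB] <-]]].
      by rewrite lte_fin ltNge a0.
    by rewrite lte_fin => aB; exists B => //; apply/ball_mdistP.
  move=> [B [FB aB] /ball_mdistP xB]; rewrite /h lt_max; apply/orP; right.
  by apply: (@lt_le_trans _ _ (B.2 `^ (- s))%:E) => //; apply: ereal_sup_ubound; exists B.
have h0 x : 0 <= h x by rewrite le_max lexx.
have mh : mu_measurable mu h.
  apply: open_superlevel_measurable => // a; have [a0|a0] := leP 0%R a.
    by rewrite hE//; apply: bigcup_open => B _; exact: open_metric_ball.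
  rewrite (_ : [set x | _] = setT); first exact: openT.
  by apply/seteqP; split => x //= _; apply: lt_le_trans (h0 x); rewrite lte_fin.
exists h; split => //.
- have : controlled mu s (set0 `|` \bigcup_(B in F) ball B.1 B.2) h.
    apply: (@ctrl_bump _ _ _ _ hs hreg (cst 0) set0) => //.
      split => //; first exact: measurable_cst.
        by move=> x; rewrite lexx lee01.
      split=> [x _|x y _ _]; first exact: h0.
      by rewrite /cst add0e mule_ge0 ?lee_fin ?powR_ge0// adde_ge0.
    move=> B x FB _ Bx _; rewrite /h le_max; apply/orP; right.
    by apply: ereal_sup_ubound; exists B.
  by rewrite set0U.
- have dd : is_distr (fun l => distr mu g (eta * l)).
    by have [? gn] := is_distr_distr mu g; split => // x y xy; apply: gn; rewrite ler_pM2l.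
  have C0 : (0 <= cd ^+ 3 / theta)%R by rewrite divr_ge0 ?exprn_ge0 ?ltW.
  rewrite EFinM -muleA.
  have <- := lorentz_int_scale p0 q0 (is_distr_distr mu g) eta0.
  have <- := lorentz_int_mulc p0 q0 dd C0.
  apply: le_lorentz_int => //; first exact: is_distr_distr.
    case: dd => dd0 ddn; split => [l|x y xy]; first by rewrite mule_ge0.
    by rewrite lee_wpmul2l// ddn.
  move=> l l0; rewrite {1}/distr.
  have -> : [set x | l%:E < `|h x|] = [set x | l%:E < h x].
    by apply/seteqP; split => x /=; rewrite gee0_abs.
  rewrite hE; last exact: ltW.
  have -> : distr mu g (eta * l) = mu [set x | (eta * l)%:E < g x].
    by congr (mu _); apply/seteqP; split => x /=; rewrite gee0_abs.
  apply: (vitali_measure hreg hball cd0 hcd) => //.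
  + by move=> B [FB _]; exact: Fr.
  + exact: measurable_superlevel.
  + move=> B [FB lB]; apply: (le_trans (Fg _ FB)); apply: le_outer_measure.
    move=> x [/= gx Bx]; split => //=; apply: le_lt_trans gx.
    by rewrite lee_fin ler_pM2l// ltW.
Qed.

Definition density_const (gamma : R) : R :=
  (4 `^ (q / p) * ((cd ^+ 3 / gamma) `^ (q / p) * 12 `^ q + 12 `^ q))%R.

(** Doubling the witness makes it 1 as soon as v >= 1/2.  The function 2 h would
    already control it; the constant 12 is the one at which [controlled_density]
    can add cutoffs. *)
Lemma ctrl_double v N A h : ctrl mu s v N A h -> (forall x, 0 <= h x) ->
  ctrl mu s (fun x => mine 1 (2%:E * v x)) N A (fun x => 12%:E * h x).
Proof.
move=> [mv v01 vA N0 [vh vd]] h0.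
have vfin x : v x \is a fin_num.
  by have /andP[v0 v1] := v01 x; rewrite ge0_fin_numE// (le_lt_trans v1)// ltry.
split => //.
- apply: measurable_mine; first exact: measurable_cst.
  by apply: emeasurable_funM => //; exact: measurable_cst.
- move=> x; have /andP[v0 v1] := v01 x.
  by rewrite le_min ge_min lexx lee01/= mule_ge0.
- by move=> x Ax; rewrite vA// mule1; apply/min_idPl; rewrite lee_fin ler1n.
split.
- move=> x Nx; rewrite ge_min; apply/orP; right.
  apply: (@le_trans _ _ (2%:E * h x)); first by rewrite lee_wpmul2l// vh.
  by rewrite lee_wpmul2r// lee_fin ler_nat.
- move=> x y Nx Ny; rewrite -ge0_muleDr// muleCA.
  have := vd x y Nx Ny.
  have : 0 <= (mdist x y `^ s)%:E * (h x + h y).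
    by rewrite mule_ge0 ?lee_fin ?powR_ge0// adde_ge0.
  have /andP[] := v01 y.
  set D := (_ * (_ + _)).
  have [a ->] : exists a, v x = a%:E by exists (fine (v x)); rewrite fineK.
  have [b ->] : exists b, v y = b%:E by exists (fine (v y)); rewrite fineK.
  case: D => [d| |//]; last first.
    by move=> *; rewrite gt0_muley ?lte_fin// addey ?leey// -EFinM -EFin_min.
  rewrite -!EFinM -!EFin_min -!EFinD !lee_fin => b0 b1 d0 abd.
  have [b2|b2] := leP 1%R (2 * b)%R.
    by rewrite ge_min; apply/orP; left; lra.
  by rewrite ge_min; apply/orP; right; lra.
Qed.

(** The balls split in two kinds.  In F1 the function h exceeds r^-s / 12 on a
    proportion gamma, and [controlled_dense_balls] applies.  A ball of F2 has a
    point z of A with h z <= r^-s / 12; for x in 2 B, d(z,x) <= 3 r and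
    1 = v z <= v x + 3 r^s (r^-s / 12 + h x), so v x < 1/2 implies
    12 h x >= r^-s, and the cutoffs of these balls may be added to the doubled
    witness. *)
Lemma controlled_density A h F (gamma : R) : controlled mu s A h ->
  gradable mu h -> (0 < gamma)%R ->
  (forall B, F B -> (0 < B.2 <= 1)%R) ->
  (forall B, F B -> gamma%:E * mu (ball B.1 B.2) <= mu (A `&` ball B.1 B.2)) ->
  exists h', [/\ controlled mu s (\bigcup_(B in F) ball B.1 B.2) h', gradable mu h' &
    lpow h' <= (density_const gamma)%:E * lpow h].
Proof.
move=> [v [N cv]] gh g0 Fr FA; have [mh h0] := gh.
pose big (B : T * R) := [set x | (12^-1 * B.2 `^ (- s))%:E < h x] `&` ball B.1 B.2.
pose F1 := F `&` [set B | gamma%:E * mu (ball B.1 B.2) <= mu (big B)].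
pose F2 := F `\` F1.
have [h1 [c1 gh1 lh1]] : exists h', [/\
    controlled mu s (\bigcup_(B in F1) ball B.1 B.2) h', gradable mu h' &
    lpow h' <= ((cd ^+ 3 / gamma) `^ (q / p) * 12^-1 `^ (- q))%:E * lpow h].
  apply: controlled_dense_balls => //; first by move=> B [FB _]; exact: Fr.
  by move=> B [].
have h20 x : 0 <= 12%:E * h x by rewrite mule_ge0.
have c2 : controlled mu s (\bigcup_(B in F2) ball B.1 B.2) (fun x => 12%:E * h x).
  suff : controlled mu s (A `|` \bigcup_(B in F2) ball B.1 B.2) (fun x => 12%:E * h x).
    by apply: controlled_sub => x; right.
  apply: (ctrl_bump hs hreg (ctrl_double cv h0)) => //; first by move=> B [FB _]; exact: Fr.
  move=> B x [FB nF1] Nx Bx vx.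
  have [_ v01 vA N0 [_ vd]] := cv.
  have /andP[r0 r1] := Fr _ FB.
  have [z [[Az Bz] Nz hz]] : exists z, [/\ (A `&` ball B.1 B.2) z, ~ N z &
     h z <= (12^-1 * B.2 `^ (- s))%:E].
    apply: contrapT => nz; apply: nF1; split => //=; apply: (le_trans (FA _ FB)).
    apply: (@le_trans _ _ (mu (big B `|` N))); last first.
      by apply: (le_trans (outer_measureU2 _ _ _)); rewrite N0 adde0.
    apply: le_outer_measure => z [Az Bz]; have [|Nz] := pselect (N z); first by right.
    left; split => //=; rewrite ltNge; apply/negP => hz; apply: nz; by exists z.
  have := vd z x Nz Nx; rewrite vA//.
  have /andP[vx0 vx1] := v01 x.
  have vfin : v x \is a fin_num by rewrite ge0_fin_numE// (le_lt_trans vx1)// ltry.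
  move: vx vx0; rewrite -(fineK vfin); set a := fine (v x).
  have [c hzE] : exists c, h z = c%:E.
    exists (fine (h z)); rewrite fineK// ge0_fin_numE//; apply: le_lt_trans hz _.
    by rewrite ltry.
  have c0 : (0 <= c)%R by rewrite -lee_fin -hzE.
  move: hz; rewrite hzE lee_fin => cP.
  move: (h0 x); case: (h x) => [b| |//]; last by move=> *; rewrite gt0_muley// leey.
  rewrite lee_fin => b0; rewrite -!EFinM -EFin_min -!EFinD !lee_fin lte_fin.
  move=> a2 a0 key.
  have dzx : (mdist z x <= 3 * B.2)%R.
    have := metric_triangle z B.1 x; rewrite (metric_sym z B.1); move/ball_mdistP : Bz.
    by move: Bx; lra.
  have P0 : (0 < B.2 `^ s)%R by rewrite powR_gt0.
  have dP : (mdist z x `^ s <= 3 * B.2 `^ s)%R.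
    have /andP[s0 s1] := hs.
    apply: (@le_trans _ _ ((3 * B.2) `^ s)%R).
      apply: ge0_ler_powR; rewrite ?nnegrE ?mdist_ge0 ?mulr_ge0 ?(ltW r0) ?(ltW s0)//.
    rewrite powRM ?(ltW r0)// ler_pM2r//; apply: ler1_powR => //.
    by rewrite ler1n.
  have iP : (B.2 `^ (- s) = (B.2 `^ s)^-1)%R by rewrite powRN.
  rewrite iP in cP *; set P := (B.2 `^ s)%R in P0 dP cP *.
  have a12 : (a < 1 / 2)%R.
    by move: a2; rewrite gt_min ltxx/= => ?; lra.
  have e1 : (mdist z x `^ s * (c + b) <= 3 * P * (12^-1 * P^-1 + b))%R.
    apply: ler_pM => //; rewrite ?powR_ge0 ?addr_ge0// lerD2r//.
  have e2 : (3 * P * (12^-1 * P^-1 + b) = 1 / 4 + 3 * (P * b))%R.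
    by field; rewrite gt_eqF.
  have e3 : (1 <= 12 * (P * b))%R by move: key e1 e2 a12; lra.
  by rewrite -(ler_pM2l P0) mulfV ?gt_eqF// mulrCA.
have h12 : gradable mu (fun x => 12%:E * h x).
  by split => //; apply: emeasurable_funM => //; exact: measurable_cst.
exists (supn (pair_seq h1 (fun x => 12%:E * h x))); split.
- apply: controlled_sub (controlled_pair gh1.2 h20 c1 c2) => x [B FB Bx].
  by have [FB1|FB1] := pselect (F1 B); [left|right]; exists B.
- exact: gradable_pair.
- apply: (le_trans (lorentz_pow_pair mu p0 q0 gh1.2 h20)).
  rewrite /density_const EFinM -muleA lee_wpmul2l ?lee_fin ?powR_ge0//.
  rewrite [X in _ <= X * _]EFinD ge0_muleDl ?lee_fin ?mulr_ge0 ?powR_ge0//; apply: leeD.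
    apply: (le_trans lh1).
    by rewrite powRN -(powR_inv1 (ler0n R 12)) powRAC powR_inv1 ?powR_ge0// invrK.
  by rewrite lorentz_pow_scale.
Qed.

End BadBalls.

(** * The points where u is infinite *)

Section PolarFailure.
Context {R : realType} {T : pointedMetricType R}.
Variable mu : {outer_measure set T -> \bar R}.
Variables s p q : R.
Hypothesis hs : (0 < s <= 1)%R.
Hypotheses (p0 : (0 < p)%R) (q0 : (0 < q)%R).
Hypothesis hreg : borel_regular mu.
Hypothesis hball : balls_pos_finite mu.
Local Notation X := (caratheodory_type mu).
Local Notation M := (mu : set X -> \bar R).
Local Open Scope ereal_scope.
Implicit Types (u v h g : T -> \bar R) (A N Z E : set T) (F : set (T * R)).
Local Notation lpow := (lorentz_pow mu p q).
Local Notation norm := (lorentz_norm mu p q).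
Local Notation polar := (polar mu s p q).

Lemma within_ball u E x (W : set (\bar R)) : {within ~` E, continuous u} -> ~ E x ->
  nbhs (u x) W -> exists2 r : R, (0 < r)%R & forall y, ball x r y -> ~ E y -> W (u y).
Proof.
move=> /subspace_continuousP cu Ex Wx.
have /nbhs_ballP[r r0 rW] := cu x Ex W Wx.
by exists r => // y /rW.
Qed.

Lemma capacity_small (e : R) : (0 < e)%R -> exists2 d : R, (0 < d)%R &
  forall A, capacity mu norm s A < d%:E ->
  exists U h, [/\ open U, A `<=` U, controlled mu s U h, gradable mu h &
    lpow h <= e%:E].
Proof.
move=> e0; have c0 : (0 < 4 `^ (q / p) :> R)%R by rewrite powR_gt0.
pose a := (e / 2 / 4 `^ (q / p))%R.
have a0 : (0 < a)%R by rewrite !divr_gt0.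
exists (a `^ q^-1)%R; first by rewrite powR_gt0.
move=> A /(capacity_lt_controlled p0 q0)[U [h [oU AU cU gh he]]].
exists U, h; split => //; apply: (le_trans he).
rewrite -powRrM mulVf ?gt_eqF// powRr1 ?(ltW a0)// lee_fin le_eqVlt; apply/orP; left.
by apply/eqP; rewrite /a; field; rewrite gt_eqF.
Qed.

Lemma quasicontinuous_polar_ext u (e : R) : quasicontinuous mu norm s u -> (0 < e)%R ->
  exists U E h, [/\ open U, E `<=` U, controlled mu s U h, gradable mu h &
    lpow h <= e%:E] /\ {within ~` E, continuous u}.
Proof.
move=> qu e0; have [d d0 hd] := capacity_small e0.
have [E cE uE] := qu d d0.
have [U [h [oU EU cU gh he]]] := hd E cE.
by exists U, E, h; split.
Qed.

Lemma distr_indic A l : (0 < l)%R ->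
  distr mu (fun x => (\1_A x)%:E) l = if (l < 1)%R then mu A else 0.
Proof.
move=> l0; rewrite /distr; case: ifPn => l1.
  congr (mu _); apply/seteqP; split => x /=.
    rewrite indicE; have [/set_mem//|_] := boolP (x \in A).
    by rewrite /= normr0 lte_fin ltNge (ltW l0).
  by move=> Ax; rewrite indicE mem_set//= normr1 lte_fin.
rewrite (_ : [set x | _] = set0) ?outer_measure0// -subset0 => x /=.
rewrite -leNgt in l1; rewrite lte_fin ltNge => /negP; apply.
rewrite indicE; case: (x \in A) => /=; first by rewrite normr1.
by rewrite normr0 ltW.
Qed.

Lemma lorentz_pow_indic A : lpow (fun x => (\1_A x)%:E) = (q^-1)%:E * mu A `^ (q / p).
Proof.
rewrite -lorentz_int_indic//; apply: eq_integral => l.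
by rewrite inE/= in_itv/= andbT => l0; rewrite distr_indic.
Qed.

Lemma hajlasz_hom_gradient u : hajlasz_hom mu norm s u ->
  exists g, [/\ sgradient mu s u g, gradable mu g & lpow g < +oo].
Proof.
move=> [_ /ereal_inf_lt[_ [g Gg <-] gfin]]; exists g; split => //.
  by have [] := Gg.
by rewrite -(lorentz_norm_lty _ _ q0).
Qed.

Definition abs_gt u (l : R) : set T := [set x | l%:E < `|u x|].

(** The witness is the minimum of a cutoff of the ball and of the truncation of
    |u| / l - 1 to [0, 1].  It vanishes off the set whose indicator is part of
    the control, and this indicator absorbs the bound by 1 and the Hoelder
    constant r^-s <= 1 of the cutoff;
    g / l is a gradient of the truncation. *)
Lemma controlled_superlevel u g (x0 : T) (r l : R) : L0 mu u -> sgradient mu s u g ->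
  (1 <= r)%R -> (0 < l)%R ->
  controlled mu s (ball x0 r `&` abs_gt u (2 * l))
    (supn (pair_seq (fun x => (l^-1)%:E * g x)
       (fun x => (\1_(ball x0 (2 * r)%R `&` abs_gt u l) x)%:E))).
Proof.
move=> [mu_ uoo] [mg g0 [N N0 ug]] r1 l0.
set A := ball x0 (2 * r)%R `&` _; set h := supn _.
have r0 : (0 < r)%R by apply: lt_le_trans r1.
have gh x : (l^-1)%:E * g x <= h x by exact: (supn_pairl _ _ x).
have Ah x : (\1_A x)%:E <= h x by exact: (supn_pairr _ _ x).
have h0 x : 0 <= h x by apply: le_trans (Ah x); rewrite lee_fin.
pose c x := cutoff (x0, r) x.
pose a x := mine 1 (maxe 0 ((l^-1)%:E * `|u x| - 1)).
have mabs : mu_measurable mu (fun x => `|u x|) by exact: measurableT_comp.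
have ma : mu_measurable mu a.
  apply: measurable_mine; first exact: measurable_cst.
  apply: measurable_maxe; first exact: measurable_cst.
  apply: emeasurable_funD; last exact: measurable_cst.
  by apply: emeasurable_funM => //; exact: measurable_cst.
have mc : mu_measurable mu (fun x => (c x)%:E).
  apply: open_superlevel_measurable => // b.
  rewrite (_ : [set x | _] = [set x | (b < c x)%R]); first exact: open_cutoff_gt.
  by apply/seteqP; split => x /=; rewrite lte_fin.
have a01 x : 0 <= a x <= 1 by rewrite /a le_min ge_min lexx lee01 le_max lexx.
pose w x := mine (c x)%:E (a x).
pose N' := N `|` [set x | `|u x| = +oo].
have wA x : ~ A x -> w x = 0.
  move=> nA; apply/eqP; rewrite eq_le; apply/andP; split; last first.
    by rewrite le_min lee_fin cutoff_ge0; have /andP[] := a01 x.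
  rewrite ge_min; have [xl|xl] := ltP l%:E `|u x|.
    apply/orP; left; rewrite lee_fin /c cutoff_eq0//= leNgt; apply/negP => xr.
    by apply: nA; split => //; apply/ball_mdistP.
  apply/orP; right; rewrite /a ge_min; apply/orP; right; rewrite ge_max lexx andTb.
  rewrite leeBlDr// add0e; apply: (@le_trans _ _ ((l^-1)%:E * l%:E)).
    by rewrite lee_wpmul2l// lee_fin invr_ge0 ltW.
  by rewrite -EFinM mulVf// gt_eqF.
have w1 x : w x <= 1 by rewrite ge_min lee_fin cutoff_le1.
have w0 x : 0 <= w x by rewrite le_min lee_fin cutoff_ge0; have /andP[] := a01 x.
have Ah1 x : A x -> 1 <= h x.
  by move=> Ax; apply: le_trans (Ah x); rewrite indicE mem_set.
exists w, N'; split.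
- exact: measurable_mine.
- by move=> x; rewrite w0 w1.
- move=> x [Bx /= ul]; apply/eqP; rewrite eq_le w1/= le_min; apply/andP; split.
    by rewrite lee_fin /c cutoff_eq1.
  rewrite /a le_min lexx andTb le_max; apply/orP; right.
  rewrite leeBrDr//; apply: (@le_trans _ _ ((l^-1)%:E * (2 * l)%:E)).
    by rewrite -EFinM mulrCA mulVf ?mulr1 ?gt_eqF// -EFinD.
  by rewrite lee_wpmul2l ?lee_fin ?invr_ge0 ?(ltW l0)// ltW.
- apply/eqP; rewrite eq_le outer_measure_ge0 andbT.
  by apply: (le_trans (outer_measureU2 _ _ _)); rewrite N0 uoo adde0.
split.
- move=> x _; have [Ax|nA] := pselect (A x); last by rewrite wA.
  by apply: le_trans (w1 x) (Ah1 x Ax).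
move=> x y Nx Ny; have D0 : 0 <= (mdist x y `^ s)%:E * (h x + h y).
  by rewrite mule_ge0 ?lee_fin ?powR_ge0// adde_ge0.
have [Ax|nA] := pselect (A x); last by rewrite wA// adde_ge0.
have [cy|cy] := leP (c y)%:E (a y).
  rewrite [w y]/w; move/min_idPl : (cy) => ->.
  apply: (@le_trans _ _ (c x)%:E); first by rewrite ge_min lexx.
  have := cutoff_holder x y hs (B := (x0, r)) r0; rewrite -lee_fin => /le_trans; apply.
  rewrite EFinD EFinM leeD2l// lee_wpmul2l ?lee_fin ?powR_ge0//=.
  apply: le_trans (leeDl _ (h0 y)); apply: le_trans (Ah1 x Ax).
  rewrite lee_fin powRN invf_le1 ?powR_gt0//.
  by rewrite -(powRr0 r) ler_powR//; have /andP[/ltW] := hs.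
rewrite [w y]/w; move/ltW/min_idPr : (cy) => ->.
apply: (@le_trans _ _ (a x)); first by rewrite ge_min lexx orbT.
have ufin z : ~ N' z -> u z \is a fin_num.
  move=> Nz; rewrite fin_num_abs ltey; apply/eqP => uz; apply: Nz; by right.
have Nx' : ~ N x by move=> ?; apply: Nx; left.
have Ny' : ~ N y by move=> ?; apply: Ny; left.
have key : (l^-1)%:E * `|u x - u y| <= (mdist x y `^ s)%:E * (h x + h y).
  apply: (@le_trans _ _ ((l^-1)%:E * ((mdist x y `^ s)%:E * (g x + g y)))).
    by rewrite lee_wpmul2l ?lee_fin ?invr_ge0 ?(ltW l0)// ug.
  rewrite muleCA lee_wpmul2l ?lee_fin ?powR_ge0// ge0_muleDr//.
  by apply: leeD.
move: key D0; rewrite /a -(fineK (ufin _ Nx)) -(fineK (ufin _ Ny)).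
set D := ((_ `^ s)%:E * _); case: D => [d| |//]; last first.
  by move=> *; rewrite addey ?leey//= -EFin_max -EFin_min.
rewrite /= -?EFinM -?EFinB -?EFin_max -?EFin_min -?EFinD !lee_fin => ud d0.
apply: unit_trunc_lip.
rewrite (_ : _ - _ = l^-1 * (`|fine (u x)| - `|fine (u y)|))%R; last by ring.
rewrite normrM.
rewrite ger0_norm ?invr_ge0 ?(ltW l0)//; apply: le_trans ud.
rewrite ler_wpM2l ?invr_ge0 ?(ltW l0)//.
exact: ler_dist_dist.
Qed.

Lemma abs_gt_ball_small u (x0 : T) (r d : R) : L0 mu u -> (0 < r)%R -> (0 < d)%R ->
  \forall k \near \oo, mu (ball x0 r `&` abs_gt u k.+1%:R) <= d%:E.
Proof.
move=> [mu_ uoo] r0 d0.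
have mabs : mu_measurable mu (fun x => `|u x|) by exact: measurableT_comp.
pose F (k : nat) : set X := ball x0 r `&` abs_gt u k.+1%:R.
have mF k : measurable (F k).
  by apply: measurableI; [exact: measurable_metric_ball|exact: measurable_superlevel].
have capF : \bigcap_k F k `<=` [set x | `|u x| = +oo].
  move=> x Fx /=; move: (fun k => (Fx k I).2); rewrite /abs_gt /=.
  have := abse_ge0 (u x); case: `|u x| => [b| |//] // b0 H; exfalso.
  have := H (Num.truncn b); rewrite lte_fin => /lt_trans => /(_ _ (truncnS_gt b)).
  by rewrite ltxx.
have ff : M (F 0%N) < +oo.
  by apply: le_lt_trans (hball x0 r0).2; apply: le_outer_measure => x [].
have nF : nonincreasing_seq F.
  move=> m n mn; rewrite subsetEset => x [Bx ux]; split => //.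
  by apply: le_lt_trans ux; rewrite lee_fin ler_nat ltnS.
have mcap : measurable (\bigcap_k F k) by apply: bigcap_measurableType => k _; exact: mF.
have cF := @nonincreasing_cvg_mu _ X R M F ff mF mcap nF.
have cap0 : M (\bigcap_k F k) = 0.
  by apply/eqP; rewrite eq_le measure_ge0 andbT -uoo le_outer_measure.
have capd : M (\bigcap_k F k) < d%:E by rewrite cap0 lte_fin.
have [n _ Hn] := cF _ (open_ereal_lt' capd).
by exists n => // k nk; exact/ltW/Hn.
Qed.

(** In a ball, {|u| > 2 l} is controlled by max(g / l, 1_{|u| > l}), which is
    small for large l as u is finite almost everywhere.  This set need not be
    open; but off a set E of small capacity u is continuous, so that it
    contains, together with E, a neighbourhood of each point outside E where
    |u| = oo. *)
Lemma polar_infinite u : hajlasz_hom mu norm s u -> quasicontinuous mu norm s u ->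
  polar [set x | `|u x| = +oo].
Proof.
move=> hu qu; have uL0 : L0 mu u by case: hu.
have [g [Gg gg gfin]] := hajlasz_hom_gradient hu.
suff pn (n : nat) : polar (ball point n.+1%:R `&` [set x | `|u x| = +oo]).
  apply: sub_polar (polar_bigcup p0 q0 pn) => x ux.
  exists (Num.truncn (mdist point x)) => //; split => //; apply/ball_mdistP.
  exact: truncnS_gt.
move=> e e0; have c0 : (0 < 4 `^ (q / p) :> R)%R by rewrite powR_gt0.
pose e1 := (e / 2 / 4 `^ (q / p))%R.
have e10 : (0 < e1)%R by rewrite !divr_gt0.
pose e2 := (e1 / 2 / 4 `^ (q / p))%R.
have e20 : (0 < e2)%R by rewrite !divr_gt0.
have [U [E [hE [[oU EU cU gU hUe] uE]]]] := quasicontinuous_polar_ext qu e10.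
have t0 : (0 < q / p)%R by rewrite divr_gt0.
have [K KE] : exists K, lpow g = K%:E.
  by exists (fine (lpow g)); rewrite fineK// ge0_fin_numE// lorentz_pow_ge0.
have K0 : (0 <= K)%R by rewrite -lee_fin -KE lorentz_pow_ge0.
pose r : R := n.+1%:R.
have r1 : (1 <= r)%R by rewrite ler1n.
have r20 : (0 < 2 * r)%R by rewrite mulr_gt0// (lt_le_trans _ r1).
pose d := ((e2 * q) `^ (q / p)^-1)%R.
have d0 : (0 < d)%R by rewrite powR_gt0// mulr_gt0.
have near1 := abs_gt_ball_small point uL0 r20 d0.
have near2 : \forall k \near \oo, (k.+1%:R^-1 `^ q * K <= e2)%R.
  have : ((k.+1%:R^-1 : R) `^ q * K)%R @[k --> \oo] --> (0 * K : R)%R.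
    by apply: cvgM; [exact: cvg_harmonic_powR|exact: cvg_cst].
  by rewrite mul0r => /cvgr_le; apply.
have [k [kA kg]] : exists k, mu (ball point (2 * r)%R `&` abs_gt u k.+1%:R) <= d%:E /\
    (k.+1%:R^-1 `^ q * K <= e2)%R.
  by have [k []] := filter_ex (filterI near1 near2); exists k.
pose l : R := k.+1%:R.
have l0 : (0 < l)%R by rewrite ltr0n.
have cL := controlled_superlevel point uL0 Gg r1 l0.
set hL := supn _ in cL.
have gL1 : gradable mu (fun x => (l^-1)%:E * g x).
  split; last by move=> x; rewrite mule_ge0 ?gg.2// lee_fin invr_ge0 ltW.
  by apply: emeasurable_funM; [exact: measurable_cst|exact: gg.1].
have gL2 : gradable mu (fun x => (\1_(ball point (2 * r)%R `&` abs_gt u l) x)%:E).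
  split; last by move=> x; rewrite lee_fin.
  apply/measurable_EFinP; apply: measurable_indic; apply: measurableI.
    exact: measurable_metric_ball.
  by apply: measurable_superlevel; apply: measurableT_comp => //; case: uL0.
have gL : gradable mu hL by exact: gradable_pair.
have hLe : lpow hL <= e1%:E.
  apply: (le_trans (lorentz_pow_pair mu p0 q0 gL1.2 gL2.2)).
  have -> : e1%:E = (4 `^ (q / p))%:E * (e2%:E + e2%:E).
    by rewrite -EFinD -EFinM /e2; congr _%:E; field; rewrite gt_eqF.
  rewrite lee_wpmul2l ?lee_fin ?powR_ge0//; apply: leeD.
    by rewrite lorentz_pow_scale ?invr_gt0// KE -EFinM lee_fin.
  rewrite lorentz_pow_indic.
  apply: (@le_trans _ _ ((q^-1)%:E * d%:E `^ (q / p))).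
    rewrite lee_wpmul2l ?lee_fin ?invr_ge0 ?(ltW q0)//.
    by apply: le_poweR; [exact: ltW|exact: outer_measure_ge0|exact: kA].
  rewrite poweR_EFin /d -powRrM mulVf ?gt_eqF// powRr1; last exact: ltW (mulr_gt0 e20 q0).
  by rewrite -EFinM lee_fin mulrCA mulVf ?mulr1// gt_eqF.
(* W contains every point off E where u is infinite. *)
pose W := interior (ball point r `&` (E `|` abs_gt u (2 * l))).
exists (U `|` W), (supn (pair_seq hE hL)); split.
- by apply: openU => //; exact: open_interior.
- move=> x [Bx ux]; have [Ex|nE] := pselect (E x); first by left; exact: EU.
  right; rewrite /W /interior.
  have nu : nbhs (u x) (fun z => (2 * l)%:E < `|z|).
    have l20 : (0 <= 2 * l)%R by rewrite mulr_ge0// ltW.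
    move: ux => /=; case: (u x) => [b //| |] _.
      have := @open_ereal_gt' R +oo (2 * l)%:E (ltry _).
      apply: filterS => z zl; apply: (lt_le_trans zl); exact: lee_abs.
    have := @open_ereal_lt' R -oo (- (2 * l))%:E (ltNyr _).
    apply: filterS => z zl; rewrite -abseN; apply: lt_le_trans (lee_abs _).
    by rewrite lteNr.
  have [r' r'0 hr'] := within_ball uE nE nu.
  have : nbhs x (ball point r `&` ball x r').
    apply: filterI; last by apply/nbhs_ballP; exists r'.
    by apply: open_nbhs_nbhs; split => //; exact: open_metric_ball.
  apply: filterS => y [By xy]; split => //.
  have [Ey|nEy] := pselect (E y); first by left.
  by right; exact: hr'.
- have := controlled_pair gU.2 gL.2 cU cL; apply: controlled_sub => x [Ux|]; first by left.
  by move=> /interior_subset[Bx [Ex|ux]]; [left; exact: EU|right].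
- exact: gradable_pair.
- apply: (le_trans (lorentz_pow_pair mu p0 q0 gU.2 gL.2)).
  have -> : e%:E = (4 `^ (q / p))%:E * (e1%:E + e1%:E).
    by rewrite -EFinD -EFinM /e1; congr _%:E; field; rewrite gt_eqF.
  by rewrite lee_wpmul2l ?lee_fin ?powR_ge0//; apply: leeD.
Qed.

End PolarFailure.

(** * Generalized Lebesgue points *)

Section DensityClose.
Context {R : realType} {T : pointedMetricType R}.
Variable mu : {outer_measure set T -> \bar R}.
Hypothesis hball : balls_pos_finite mu.
Local Open Scope ereal_scope.
Implicit Types (u : T -> \bar R).

(** For all gamma > 0, this is approximate continuity of u at x. *)
Definition dens_close u (gamma : R) (x : T) := forall d : R, (0 < d)%R ->
  \forall r \near (0%R : R)^'+,
    mu (ball x r `&` [set y | d%:E < `|u y - u x|]) < gamma%:E * mu (ball x r).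

Lemma dens_close_le u (g1 g2 : R) x : (g1 <= g2)%R ->
  dens_close u g1 x -> dens_close u g2 x.
Proof.
move=> g12 du d d0; apply: filterS (du d d0) => r /lt_le_trans; apply.
by rewrite lee_wpmul2r ?lee_fin// outer_measure_ge0.
Qed.

Lemma ball_fin (x : T) (r : R) : (0 < r)%R ->
  exists2 m : R, (0 < m)%R & mu (ball x r) = m%:E.
Proof.
move=> r0; have [] := hball x r0; case: (mu _) => [m| |]//.
by rewrite lte_fin => m0 _; exists m.
Qed.

Lemma cvg_EFin_dist (F : set_system R) (FF : ProperFilter F) (f : R -> \bar R) (a : R) :
  (forall d : R, (0 < d)%R -> \forall r \near F, (a - d)%:E <= f r <= (a + d)%:E) ->
  f @ F --> a%:E.
Proof.
move=> H; apply: cvg_EFin.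
  apply: filterS (H 1%R ltr01) => r /andP[h1 h2].
  by rewrite fin_numElt (lt_le_trans _ h1) ?ltNyr// (le_lt_trans h2)// ltry.
apply/cvgrPdist_le => d d0; apply: filterS (H d d0) => r /=.
case: (f r) => [b| |]//= /andP[]; rewrite ?leNye_eq ?leye_eq// !lee_fin => h1 h2.
by rewrite ler_norml; apply/andP; split; lra.
Qed.

(** The set where |u - a| > d has density less than min(gamma, 1 - gamma), so it
    is too small to raise the gamma-median above a + d and its complement too
    large for the median to fall below a - d. *)
Lemma dens_close_gen_lebesgue u x : `|u x| <> +oo ->
  (forall gamma : R, (0 < gamma)%R -> dens_close u gamma x) ->
  gen_lebesgue_point mu u x.
Proof.
move=> ux du gamma /andP[g0 g1].
have ufin : u x \is a fin_num by rewrite fin_num_abs ltey; exact/eqP.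
move: (du); rewrite /dens_close -(fineK ufin); set a := fine (u x) => {}du.
split; apply: cvg_EFin_dist => d d0.
- near=> r; have r0 : (0 < r)%R by [].
  have [m m0 mE] := ball_fin x r0.
  rewrite sub0r add0r; apply/andP; split.
    apply: (@le_trans _ _ 0); first by rewrite lee_fin oppr_le0 ltW.
    apply: le_ereal_inf_tmp => _ [b /= bm <-]; rewrite lee_fin leNgt; apply/negP => b0.
    move: bm; rewrite (_ : _ `&` _ = ball x r); last first.
      apply/seteqP; split => [y []//|y By]; split => //=.
      by apply: lt_le_trans (abse_ge0 _); rewrite lte_fin.
    by rewrite mE -EFinM lte_fin ltNge ger_pMl// ltW.
  apply: ereal_inf_lbound; exists d => //=.
  by near: r; exact: du.
- near=> r; have r0 : (0 < r)%R by [].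
  have [m m0 mE] := ball_fin x r0.
  have dg : mu (ball x r `&` [set y | d%:E < `|u y - a%:E|]) < gamma%:E * mu (ball x r).
    by near: r; exact: du.
  have dg' : mu (ball x r `&` [set y | d%:E < `|u y - a%:E|]) <
      (1 - gamma)%:E * mu (ball x r).
    by near: r; apply: du => //; rewrite subr_gt0.
  apply/andP; split; last first.
    apply: ereal_inf_lbound; exists (a + d)%R => //=; apply: le_lt_trans dg.
    apply: le_outer_measure => y [By /= uy]; split => //=.
    move: uy; case: (u y) => [z| |]//=; rewrite ?ltry// !lte_fin => uy.
    by apply: (lt_le_trans _ (ler_norm _)); lra.
  apply: le_ereal_inf_tmp => _ [b /= bm <-]; rewrite lee_fin leNgt; apply/negP => ba.
  have : mu (ball x r) < mu (ball x r).
    apply: (@le_lt_trans _ _ (mu (ball x r `&` [set y | b%:E < u y]) +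
      mu (ball x r `&` [set y | d%:E < `|u y - a%:E|]))).
      apply: le_trans (outer_measureU2 _ _ _); apply: le_outer_measure => y By.
      have [uy|uy] := ltP b%:E (u y); [by left|right; split => //=].
      move: uy; case: (u y) => [z| |]//=; rewrite ?ltry// lee_fin lte_fin => uy.
      by rewrite -normrN; apply: (lt_le_trans _ (ler_norm _)); lra.
    rewrite [ltRHS](_ : _ = gamma%:E * mu (ball x r) + (1 - gamma)%:E * mu (ball x r)).
      exact: lteD.
    by rewrite mE -!EFinM -EFinD; congr _%:E; ring.
  by rewrite ltxx.
Unshelve. all: by end_near. Qed.

End DensityClose.

Section PolarDensityFailure.
Context {R : realType} {T : pointedMetricType R}.
Variable mu : {outer_measure set T -> \bar R}.
Variables s p q : R.
Hypothesis hs : (0 < s <= 1)%R.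
Hypotheses (p0 : (0 < p)%R) (q0 : (0 < q)%R).
Hypothesis hreg : borel_regular mu.
Hypothesis hball : balls_pos_finite mu.
Variable cd : R.
Hypothesis cd0 : (0 < cd)%R.
Hypothesis hcd : forall (x : T) (r : R), (0 < r)%R ->
  (mu (ball x (2 * r)%R) <= cd%:E * mu (ball x r))%E.
Local Open Scope ereal_scope.
Implicit Types (u : T -> \bar R).
Local Notation norm := (lorentz_norm mu p q).
Local Notation polar := (polar mu s p q).

(** Let U be open, controlled by a small function, such that u is continuous
    relatively to its complement.  If x lies outside U and density fails at x,
    then U has density at least gamma in some ball centred at x, and
    [controlled_density] applies to the family of all such balls. *)
Lemma polar_not_dens_close u (gamma : R) : quasicontinuous mu norm s u -> (0 < gamma)%R ->
  polar [set x | `|u x| <> +oo /\ ~ dens_close mu u gamma x].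
Proof.
move=> qu g0 e e0; pose K := density_const p q cd gamma.
have K0 : (0 <= K)%R.
  by rewrite /K /density_const mulr_ge0 ?addr_ge0 ?mulr_ge0 ?powR_ge0.
have c0 : (0 < 4 `^ (q / p) :> R)%R by rewrite powR_gt0.
have K1 : (0 < 1 + K)%R by rewrite ltr_pwDl.
pose e1 := (e / (1 + K) / 4 `^ (q / p))%R.
have e10 : (0 < e1)%R by rewrite !divr_gt0.
have [U [E [hE [[oU EU cU gU hUe] uE]]]] := quasicontinuous_polar_ext p0 q0 qu e10.
pose F := [set B : T * R | (0 < B.2 <= 1)%R /\
  gamma%:E * mu (ball B.1 B.2) <= mu (U `&` ball B.1 B.2)].
have [h' [cF gF hF]] : exists h', [/\
    controlled mu s (\bigcup_(B in F) ball B.1 B.2) h', gradable mu h' &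
    lorentz_pow mu p q h' <= K%:E * lorentz_pow mu p q hE].
  apply: (controlled_density hs p0 q0 hreg hball cd0 hcd cU gU g0).
    by move=> B [].
  by move=> B [].
exists (U `|` \bigcup_(B in F) ball B.1 B.2), (supn (pair_seq hE h')); split.
- apply: openU => //; apply: bigcup_open => B _; exact: open_metric_ball.
- move=> x [/= ux ndc]; apply: contrapT => /not_orP[nU nF]; apply: ndc => d d0.
  have nE : ~ E x by move=> /EU.
  have ufin : u x \is a fin_num by rewrite fin_num_abs ltey; exact/eqP.
  have nu : nbhs (u x) (fun z => `|z - u x| <= d%:E).
    rewrite -(fineK ufin); set a := fine (u x).
    have h1 := @open_ereal_gt' R a%:E (a - d)%:E; rewrite lte_fin in h1.
    have h2 := @open_ereal_lt' R a%:E (a + d)%:E; rewrite lte_fin in h2.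
    have : nbhs a%:E ([set z | (a - d)%:E < z] `&` [set z | z < (a + d)%:E]).
      by apply: filterI; [apply: h1|apply: h2]; lra.
    apply: filterS => -[z| |] [] //=.
    rewrite !lte_fin lee_fin => z1 z2; rewrite ler_norml; apply/andP; split; lra.
  have [r1 r10 hr1] := within_ball uE nE nu.
  near=> r; have r0 : (0 < r)%R by [].
  rewrite ltNge; apply/negP => big; apply: nF; exists (x, r) => /=; last first.
    by apply/ball_mdistP; rewrite mdistxx.
  split => /=.
    rewrite r0/=; near: r; exact: nbhs_right_le.
  apply: (le_trans big); apply: le_outer_measure => y [By /= uy]; split => //.
  apply: EU; apply: contrapT => nEy; move: uy; rewrite ltNge => /negP; apply.
  apply: hr1 => //; apply: le_ball By; near: r; exact: nbhs_right_le.
- by have := controlled_pair gU.2 gF.2 cU cF.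
- exact: gradable_pair.
- apply: (le_trans (lorentz_pow_pair mu p0 q0 gU.2 gF.2)).
  have -> : e%:E = (4 `^ (q / p))%:E * (e1%:E + (K * e1)%:E).
    rewrite -EFinD -EFinM /e1; congr _%:E; field.
    by rewrite !gt_eqF.
  rewrite lee_wpmul2l ?lee_fin ?powR_ge0//; apply: leeD => //.
  by apply: (le_trans hF); rewrite [X in _ <= X]EFinM; apply: lee_wpmul2l.
Unshelve. all: by end_near. Qed.

Lemma polar_not_dens_close_all u : hajlasz_hom mu norm s u ->
  quasicontinuous mu norm s u ->
  polar [set x | ~ (`|u x| <> +oo /\
    forall gamma : R, (0 < gamma)%R -> dens_close mu u gamma x)].
Proof.
move=> hu qu.
have pA := polar_infinite hs p0 q0 hreg hball hu qu.
have pB : polar (\bigcup_n [set x | `|u x| <> +oo /\ ~ dens_close mu u (n.+1%:R^-1) x]).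
  by apply: polar_bigcup => // n; apply: polar_not_dens_close.
apply: sub_polar (polarU p0 q0 pA pB) => x /= nx.
have [ux|ux] := eqVneq `|u x| +oo; first by left.
right; apply: contrapT => nB; apply: nx; split; first exact/eqP.
move=> gamma g0; have [n ng] : exists n, (n.+1%:R^-1 < gamma)%R.
  by have /ltr_add_invr[k] := g0; rewrite add0r => ?; exists k.
apply: (@dens_close_le _ _ _ _ n.+1%:R^-1%R); first exact: ltW.
by apply: contrapT => ndc; apply: nB; exists n => //; split => //; exact/eqP.
Qed.

End PolarDensityFailure.

(** * Superlevel sets of the gradient at small scales *)

Section Levels.
Context {R : realType} {T : pointedMetricType R}.
Variable mu : {outer_measure set T -> \bar R}.
Variables s p q : R.
Hypothesis hs : (0 < s <= 1)%R.
Hypotheses (p0 : (0 < p)%R) (q0 : (0 < q)%R).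
Hypothesis hreg : borel_regular mu.
Hypothesis hball : balls_pos_finite mu.
Variable cd : R.
Hypothesis cd0 : (0 < cd)%R.
Hypothesis hcd : forall (x : T) (r : R), (0 < r)%R ->
  (mu (ball x (2 * r)%R) <= cd%:E * mu (ball x r))%E.
Local Open Scope ereal_scope.
Implicit Types (u g h : T -> \bar R) (F : set (T * R)).
Local Notation lpow := (lorentz_pow mu p q).
Local Notation polar := (polar mu s p q).

(** The levels are measured in units of r^-s, the scale of a gradient of a
    function that varies by 1 over a ball of radius r. *)
Definition level_set g (L eta : R) (j : nat) (B : T * R) : set T :=
  [set x | (L ^+ j * eta * B.2 `^ (- s))%:E < g x] `&` ball B.1 B.2.

Definition level_const (eta theta : R) : R :=
  (2 * (2 `^ (q / p) * (cd ^+ 3 / theta) `^ (q / p) * eta `^ (- q)))%R.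

Lemma powR_exp (x a : R) j : (0 <= x)%R -> ((x ^+ j) `^ a = (x `^ a) ^+ j)%R.
Proof. by move=> x0; rewrite -(powR_mulrn j x0) powRAC powR_mulrn// powR_ge0. Qed.

(** For each j, [controlled_dense_balls] controls the balls that are bad at level
    j, with a constant proportional to (tau^-1)^(j q/p) L^(-j q); the weight
    2^(j q/p) of the supremum over j is still beaten, and the constants sum. *)
Lemma controlled_levels g F (L tau eta theta : R) : gradable mu g ->
  (0 < eta)%R -> (0 < theta)%R -> (0 < L)%R -> (0 < tau)%R ->
  (2 `^ (q / p) * (tau^-1) `^ (q / p) * L `^ (- q) <= 2^-1)%R ->
  (forall B, F B -> (0 < B.2 <= 1)%R) ->
  (forall B, F B -> exists j,
     (theta * tau ^+ j)%:E * mu (ball B.1 B.2) <= mu (level_set g L eta j B)) ->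
  exists h, [/\ controlled mu s (\bigcup_(B in F) ball B.1 B.2) h, gradable mu h &
    lpow h <= (level_const eta theta)%:E * lpow g].
Proof.
move=> gg eta0 th0 L0 tau0 om Fr Fj.
pose G := lpow g; have G0 : 0 <= G by exact: lorentz_pow_ge0.
pose Fn j := F `&` [set B | (theta * tau ^+ j)%:E * mu (ball B.1 B.2) <=
   mu (level_set g L eta j B)].
have /choice[h hP] : forall j, exists h, [/\
    controlled mu s (\bigcup_(B in Fn j) ball B.1 B.2) h, gradable mu h &
    lpow h <= ((cd ^+ 3 / (theta * tau ^+ j)) `^ (q / p) * (L ^+ j * eta) `^ (- q))%:E
      * lpow g].
  move=> j; apply: (controlled_dense_balls hs p0 q0 hreg hball cd0 hcd) => //.
  - by rewrite mulr_gt0// exprn_gt0.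
  - by rewrite mulr_gt0// exprn_gt0.
  - by move=> B [FB _]; exact: Fr.
  - by move=> B [].
have h0 n x : 0 <= h n x by have [_ [_ ]] := hP n.
exists (supn h); split.
- have : controlled mu s (\bigcup_j \bigcup_(B in Fn j) ball B.1 B.2) (supn h).
    by apply: controlled_bigcup => // n; have [] := hP n.
  apply: controlled_sub => x [B FB Bx]; have [j Bj] := Fj _ FB.
  by exists j => //; exists B.
- by apply: gradable_supn => n; have [] := hP n.
apply: (le_trans (lorentz_pow_supn _ p0 q0 h0)).
pose c := (2 `^ (q / p) * (cd ^+ 3 / theta) `^ (q / p) * eta `^ (- q))%R.
have c0 : (0 <= c)%R by rewrite !mulr_ge0 ?powR_ge0.
pose w := (2 `^ (q / p) * (tau^-1) `^ (q / p) * L `^ (- q))%R.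
have cE j : ((2 ^ j.+1)%:R `^ (q / p) *
    ((cd ^+ 3 / (theta * tau ^+ j)) `^ (q / p) * (L ^+ j * eta) `^ (- q)) = c * w ^+ j)%R.
  have -> : (cd ^+ 3 / (theta * tau ^+ j) = cd ^+ 3 / theta * tau^-1 ^+ j)%R.
    by rewrite exprVn invfM mulrA.
  have cth0 : (0 <= cd ^+ 3 / theta)%R by rewrite divr_ge0 ?exprn_ge0// ltW.
  have tj0 : (0 <= tau^-1 ^+ j)%R by rewrite exprn_ge0// invr_ge0 ltW.
  have Lj0 : (0 <= L ^+ j)%R by rewrite exprn_ge0// ltW.
  rewrite natrX powR_exp// (powRM _ cth0 tj0) (powRM _ Lj0 (ltW eta0)).
  rewrite (powR_exp _ _ (_ : 0 <= tau^-1)%R) ?invr_ge0 ?(ltW tau0)//.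
  rewrite powR_exp ?(ltW L0)// /c /w exprS !exprMn; ring.
have w0 : (0 <= w)%R by rewrite !mulr_ge0 ?powR_ge0.
have wj j : (w ^+ j <= (2^-1) ^+ j)%R by rewrite lerXn2r ?nnegrE.
have [Gfin|] := ltP G +oo; last first.
  rewrite leye_eq => /eqP GE.
  rewrite [X in _ <= _ * X](_ : _ = +oo)// gt0_muley ?leey// lte_fin.
  by rewrite !mulr_gt0// ?powR_gt0// ?divr_gt0// exprn_gt0.
have GE : G = (fine G)%:E by rewrite fineK// ge0_fin_numE.
have fG0 : (0 <= fine G)%R by rewrite fine_ge0.
rewrite -/G GE -EFinM.
have lc0 : (0 <= level_const eta theta * fine G)%R by rewrite mulr_ge0// mulr_ge0.
apply: le_trans (epsilon_trick0 xpredT lc0).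
apply: lee_nneseries => j _.
  by move=> _; rewrite mule_ge0 ?lorentz_pow_ge0// lee_fin powR_ge0.
have [_ _ hj] := hP j.
apply: (@le_trans _ _ (((2 ^ j.+1)%:R `^ (q / p))%:E * (((cd ^+ 3 / (theta * tau ^+ j)) `^ (q / p) *
   (L ^+ j * eta) `^ (- q))%:E * G))).
  by rewrite lee_wpmul2l// lee_fin powR_ge0.
rewrite muleA -EFinM cE GE -EFinM lee_fin /level_const -/c.
rewrite [leRHS](_ : _ = c * (2^-1) ^+ j * fine G)%R; last first.
  rewrite natrX exprS exprVn; field.
  by rewrite expf_neq0.
by rewrite ler_wpM2r// ler_wpM2l.
Qed.

Definition gt_set g (a : R) : set T := [set y | a%:E < g y].

Lemma gradable_tail g n : gradable mu g ->
  gradable mu (fun x => g x * (\1_(gt_set g n%:R) x)%:E).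
Proof.
move=> [mg g0]; split; last by move=> x; rewrite mule_ge0// lee_fin.
apply: emeasurable_funM => //; apply/measurable_EFinP; apply: measurable_indic.
exact: measurable_superlevel.
Qed.

(** For r small all levels L^j eta r^-s exceed n, so that g can be replaced by
    g 1_{g > n}, whose norm tends to 0 by [lorentz_int_tail]. *)
Lemma polar_bad_levels g (L tau eta theta : R) : gradable mu g -> lpow g < +oo ->
  (0 < eta)%R -> (0 < theta)%R -> (1 <= L)%R -> (0 < tau)%R ->
  (2 `^ (q / p) * (tau^-1) `^ (q / p) * L `^ (- q) <= 2^-1)%R ->
  polar [set x | ~ exists2 r0 : R, (0 < r0)%R & forall r, (0 < r < r0)%R -> forall j,
    mu (level_set g L eta j (x, r)) < (theta * tau ^+ j)%:E * mu (ball x r)].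
Proof.
move=> gg gfin eta0 th0 L1 tau0 om e e0.
have L0 : (0 < L)%R by apply: lt_le_trans L1.
pose K := level_const eta theta.
have K0 : (0 < K)%R.
  by rewrite !mulr_gt0// ?powR_gt0// ?divr_gt0// exprn_gt0.
have [n hn] := lorentz_int_tail p0 q0 (is_distr_distr mu g) gfin (divr_gt0 e0 K0).
pose gn x := g x * (\1_(gt_set g n.+1%:R) x)%:E.
have ggn : gradable mu gn by exact: gradable_tail.
have gnE x : n.+1%:R%:E < g x -> gn x = g x.
  by move=> nx; rewrite /gn indicE mem_set// mule1.
have gn0 x : ~ n.+1%:R%:E < g x -> gn x = 0.
  by move=> nx; rewrite /gn indicE memNset// mule0.
have lgn : lpow gn <= (e / K)%:E.
  apply: le_trans hn; have [d0 dn] := is_distr_distr mu g.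
  apply: le_lorentz_int => //; first exact: is_distr_distr.
    by split => // x y xy; apply: dn; rewrite ge_max !le_max xy lexx orbT.
  move=> l l0; apply: le_outer_measure => x /=.
  rewrite gee0_abs ?ggn.2// gee0_abs ?gg.2// => lx.
  have [nx|nx] := pselect (n.+1%:R%:E < g x).
    by rewrite EFin_max gt_max nx/= -(gnE _ nx).
  by move: lx; rewrite gn0// lte_fin ltNge (ltW l0).
(* The radius below which eta r^-s >= n + 1. *)
pose r1 := Num.min 1%R ((eta / n.+1%:R) `^ s^-1)%R.
have s0 : (0 < s)%R by case/andP : hs.
have r10 : (0 < r1)%R by rewrite lt_min ltr01 powR_gt0// divr_gt0.
pose F := [set B : T * R | (0 < B.2 < r1)%R /\ exists j,
  (theta * tau ^+ j)%:E * mu (ball B.1 B.2) <= mu (level_set gn L eta j B)].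
have Fr B : F B -> (0 < B.2 <= 1)%R.
  by move=> [/andP[-> ]]; rewrite lt_min => /andP[/ltW ->].
have [h [cF gh hle]] := controlled_levels ggn eta0 th0 L0 tau0 om Fr (fun B FB => FB.2).
exists (\bigcup_(B in F) ball B.1 B.2), h; split => //.
- by apply: bigcup_open => B _; exact: open_metric_ball.
- move=> x nx; apply: contrapT => nF; apply: nx; exists r1 => // r /andP[r0 rr1] j.
  rewrite ltNge; apply/negP => bad; apply: nF; exists (x, r); last first.
    by apply/ball_mdistP; rewrite mdistxx.
  split => /=; first by rewrite r0 rr1.
  exists j; apply: (le_trans bad); apply: le_outer_measure => y [/= gy By].
  split => //=; rewrite gnE//; apply: le_lt_trans gy; rewrite lee_fin.
  apply: (@le_trans _ _ (eta * r `^ (- s))%R).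
    rewrite -ler_pdivrMl// powRN.
    rewrite -(invrK (eta^-1 * _)%R) lef_pV2 ?posrE ?powR_gt0 ?invr_gt0 ?mulr_gt0 ?invr_gt0//.
    move: rr1; rewrite lt_min => /andP[_ /ltW rr1].
    rewrite invfM invrK.
    have : (r `^ s <= ((eta / n.+1%:R) `^ s^-1) `^ s)%R.
      by apply: ge0_ler_powR; rewrite ?nnegrE ?powR_ge0 ?(ltW r0) ?(ltW s0).
    by rewrite -powRrM mulVf ?gt_eqF// powRr1// divr_ge0// ltW.
  by rewrite -mulrA ler_peMl ?exprn_ege1// mulr_ge0 ?powR_ge0// ltW.
- apply: (le_trans hle); apply: (@le_trans _ _ (K%:E * (e / K)%:E)).
    by rewrite lee_wpmul2l// lee_fin ltW.
  by rewrite -EFinM mulrCA mulfV ?mulr1// gt_eqF.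
Qed.

End Levels.

(** * Chaining *)

(** The ball B(x,rho) is fixed, a stands for u x, and N is a null set off which g
    is a gradient of u.  The chain radii decrease by the factor [chain_sigma],
    and [chain_tau] = chain_sigma^Q is the factor by which the mass bound for
    balls of these radii decreases.  As [chain_kappa] = (1 - chain_sigma) / 2,
    the radii rho kappa sigma^(j+1) sum to rho sigma / 2: chains that start in
    B(x, rho / 2) stay in B(x, rho).  The factor 1/2 in [chain_theta] leaves
    strict room in the comparison of measures. *)

Section Chain.
Context {R : realType} {T : pointedMetricType R}.
Variable mu : {outer_measure set T -> \bar R}.
Hypothesis hball : balls_pos_finite mu.
Variables c Q : R.
Hypotheses (hc : 0 < c) (hQ : 0 < Q).
Hypothesis hlow : forall (x y : T) (r rho : R), 0 < r -> r <= rho -> ball x rho y ->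
  ((c * (r / rho) `^ Q)%:E <= mu (ball y r) / mu (ball x rho))%E.
Variables s p1 L : R.
Hypotheses (hs : 0 < s <= 1) (hp1 : 0 < p1) (hL : 1 < L).

Definition chain_sigma : R := L `^ (- (p1 / Q)).
Definition chain_tau : R := L `^ (- p1).
Definition chain_kappa : R := (1 - chain_sigma) / 2.
Definition chain_theta : R := c * chain_kappa `^ Q * chain_tau / 2.
Definition chain_step (eta : R) (j : nat) : R :=
  2 * chain_kappa `^ s * eta * (chain_sigma `^ s * L) ^+ j.+1.

Local Notation sg := chain_sigma.
Local Notation tau := chain_tau.
Local Notation kap := chain_kappa.
Local Notation theta := chain_theta.

Let L0 : 0 < L. Proof. exact: lt_trans hL. Qed.

Lemma powR_lt1 (a : R) : 0 < a -> L `^ (- a) < 1.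
Proof.
move=> a0; rewrite powRN invf_lt1 ?powR_gt0//.
have := gt0_ltr_powR a0 (x:=1) (y:=L); rewrite powR1; apply => //.
  by rewrite nnegrE.
by rewrite nnegrE ltW.
Qed.

Lemma sg_gt0 : 0 < sg. Proof. exact: powR_gt0. Qed.
Lemma sg_lt1 : sg < 1. Proof. by apply: powR_lt1; rewrite divr_gt0. Qed.
Lemma tau_gt0 : 0 < tau. Proof. exact: powR_gt0. Qed.
Lemma tau_lt1 : tau < 1. Proof. exact: powR_lt1. Qed.
Lemma kap_gt0 : 0 < kap. Proof. by rewrite divr_gt0// subr_gt0 sg_lt1. Qed.
Lemma kap_le1 : kap <= 1.
Proof. by rewrite /chain_kappa; have := sg_gt0; lra. Qed.
Lemma theta_gt0 : 0 < theta.
Proof. by rewrite divr_gt0// !mulr_gt0// ?powR_gt0 ?kap_gt0 ?tau_gt0. Qed.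

Lemma sg_powQ : sg `^ Q = tau.
Proof. by rewrite /chain_sigma -powRrM mulNr divfK// gt_eqF. Qed.

Let c_le1 : c <= 1.
Proof.
have [m m0 mE] := ball_fin hball (point : T) ltr01.
have pin : ball (point : T) 1 (point : T) by exact: ballxx.
have := hlow ltr01 (lexx 1) pin.
rewrite mE divrr ?unitfE// powR1 mulr1 inver gt_eqF// -EFinM mulfV ?gt_eqF//.
Qed.

Lemma theta_le : theta <= 1 / 2.
Proof.
rewrite /chain_theta ler_pM2r ?invr_gt0//.
have k1 : kap `^ Q <= 1.
  by have := ge0_ler_powR (ltW hQ) (x:=kap) (y:=1); rewrite powR1; apply;
    rewrite ?nnegrE ?kap_le1// ltW// kap_gt0.
rewrite -[leRHS](mulr1 1) ler_pM ?(ltW tau_lt1)// ?mulr_ge0 ?powR_ge0 ?(ltW hc)//.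
by rewrite -[leRHS](mulr1 1) ler_pM ?powR_ge0 ?(ltW hc).
Qed.

Variables (u g : T -> \bar R) (N : set T) (x : T) (rho a eps eta : R).
Hypotheses (rho0 : 0 < rho) (eps0 : 0 < eps) (eta0 : 0 < eta).
Hypotheses (N0 : mu N = 0%E) (g0 : forall y, (0 <= g y)%E).
Hypothesis ug : forall y z, ~ N y -> ~ N z ->
  (`|u y - u z| <= (mdist y z `^ s)%:E * (g y + g z))%E.
Hypothesis good : forall j, (mu (level_set s g L eta j (x, rho)) <
  (theta * tau ^+ j)%:E * mu (ball x rho))%E.
Hypothesis dens : (mu (ball x rho `&` [set y | eps%:E < `|u y - a%:E|]) <
  (2^-1)%:E * mu (ball x rho))%E.

Let lev (j : nat) : R := L ^+ j * eta * rho `^ (- s).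

Let lev_le (i j : nat) : (i <= j)%N -> lev i <= lev j.
Proof.
move=> ij; rewrite /lev -!mulrA ler_pM2r ?mulr_gt0 ?powR_gt0//.
by rewrite ler_weXn2l// ltW.
Qed.

Let dist_trans (y z : T) (A B : R) : (`|u z - a%:E| <= A%:E)%E ->
  (`|u y - u z| <= B%:E)%E -> (`|u y - a%:E| <= (A + B)%:E)%E.
Proof.
case: (u z) => [b| |]; case: (u y) => [d| |] //=; rewrite ?leye_eq// !lee_fin => h1 h2.
have -> : d - a = (b - a) + (d - b) by ring.
by apply: (le_trans (ler_normD _ _)); exact: lerD.
Qed.

Let grad_step (y z : T) (r A : R) : ~ N y -> ~ N z -> mdist y z <= r ->
  (g y <= A%:E)%E -> (g z <= A%:E)%E -> (`|u y - u z| <= (r `^ s * (2 * A))%:E)%E.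
Proof.
move=> Ny Nz yz gy gz; apply: (le_trans (ug Ny Nz)).
rewrite EFinM; apply: lee_pmul.
- by rewrite lee_fin powR_ge0.
- by rewrite adde_ge0.
- rewrite lee_fin; apply: ge0_ler_powR; rewrite ?nnegrE ?mdist_ge0//.
    by have /andP[/ltW] := hs.
  exact: le_trans (mdist_ge0 _ _) yz.
- by rewrite mulr_natl mulr2n EFinD; exact: leeD.
Qed.

(** The lower mass bound makes B(y, rho kappa sigma^(j+1)) at least twice as large
    as the level set at j is allowed to be. *)
Let find_low (y : T) (j : nat) : mdist x y < rho ->
  (forall z, mdist y z < rho * kap * sg ^+ j.+1 -> mdist x z < rho) ->
  exists z, [/\ ~ N z, mdist y z < rho * kap * sg ^+ j.+1 & (g z <= (lev j)%:E)%E].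
Proof.
move=> xy yrho; set r := rho * kap * _.
have sj0 : 0 < sg ^+ j.+1 by rewrite exprn_gt0// sg_gt0.
have r0 : 0 < r by exact: mulr_gt0 (mulr_gt0 rho0 kap_gt0) sj0.
have rrho : r <= rho.
  rewrite /r -mulrA -[leRHS](mulr1 rho) ler_pM2l// -[leRHS](mulr1 1).
  by rewrite ler_pM// ?(ltW kap_gt0) ?(ltW sj0) ?kap_le1// exprn_ile1 ?(ltW sg_gt0) ?(ltW sg_lt1).
have [m m0 mE] := ball_fin hball x rho0.
have [m' m'0 m'E] := ball_fin hball y r0.
have xyb : ball x rho y by apply/ball_mdistP.
have := hlow r0 rrho xyb; rewrite mE m'E inver gt_eqF// -EFinM lee_fin.
rewrite ler_pdivlMr// => low.
have rE : (r / rho) `^ Q = kap `^ Q * tau ^+ j.+1.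
  rewrite (_ : r / rho = kap * sg ^+ j.+1); last by rewrite /r; field; rewrite gt_eqF.
  rewrite powRM ?(ltW kap_gt0) ?(ltW sj0)// powR_exp ?(ltW sg_gt0)//.
  by rewrite sg_powQ.
apply: contrapT => nz.
have : (mu (ball y r) <= mu (level_set s g L eta j (x, rho)))%E.
  apply: (@le_trans _ _ (mu (level_set s g L eta j (x, rho) `|` N))).
    apply: le_outer_measure => z /ball_mdistP yz.
    have [|Nz] := pselect (N z); first by right.
    left; split => /=; last by apply/ball_mdistP; exact: yrho.
    by rewrite ltNge; apply/negP => gz; apply: nz; exists z.
  by apply: (le_trans (outer_measureU2 _ _ _)); rewrite N0 adde0.
move=> /le_lt_trans => /(_ _ (good j)); rewrite mE m'E -EFinM lte_fin.
move: low; rewrite rE /chain_theta exprS.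
have t0 : 0 < c * (kap `^ Q * (tau * tau ^+ j)) * m.
  by rewrite !mulr_gt0 ?powR_gt0 ?kap_gt0 ?tau_gt0 ?exprn_gt0 ?tau_gt0.
have -> : c * kap `^ Q * tau / 2 * tau ^+ j * m =
  (c * (kap `^ Q * (tau * tau ^+ j)) * m) / 2 by field.
by lra.
Qed.

(** Induction on the level of y.  At level 0 a point z of B(x,rho) with |u z - a|
    <= eps and g z <= eta rho^-s is within 2 rho of y.  At level k + 1, y is
    linked to a point of level k at distance rho kappa sigma^(k+1); the radius
    in the statement shrinks with k by exactly this distance. *)
Lemma chain_bound (k : nat) (y : T) : ~ N y ->
  mdist x y < rho * (1 - sg * (1 - sg ^+ k) / 2) -> (g y <= (lev k)%:E)%E ->
  (`|u y - a%:E| <= (eps + 4 * eta + \sum_(j < k) chain_step eta j)%:E)%E.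
Proof.
have rs0 : 0 < rho `^ s by rewrite powR_gt0.
elim: k y => [|k IH] y Ny xy gy.
  rewrite big_ord0 addr0.
  move: xy; rewrite expr0 subrr mulr0 mul0r subr0 mulr1 => xy.
  have [z [Nz xz uz gz]] : exists z, [/\ ~ N z, mdist x z < rho,
      (`|u z - a%:E| <= eps%:E)%E & (g z <= (lev 0)%:E)%E].
    apply: contrapT => nz; have [m m0 mE] := ball_fin hball x rho0.
    have : (mu (ball x rho) <= mu (level_set s g L eta 0 (x, rho)) +
        mu (ball x rho `&` [set y | (eps%:E < `|u y - a%:E|)%E]))%E.
      apply: (@le_trans _ _ (mu ((level_set s g L eta 0 (x, rho) `|`
         (ball x rho `&` [set y | (eps%:E < `|u y - a%:E|)%E])) `|` N))).
        apply: le_outer_measure => z xz.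
        have [|Nz] := pselect (N z); first by right.
        left; have [gz|gz] := ltP (lev 0)%:E (g z); first by left; split.
        right; split => //=; rewrite ltNge; apply/negP => uz; apply: nz.
        by exists z; split => //; apply/ball_mdistP.
      apply: (le_trans (outer_measureU2 _ _ _)); rewrite N0 adde0.
      exact: outer_measureU2.
    move=> /le_lt_trans => /(_ _ (lteD (good 0) dens)).
    rewrite mE -!EFinM -EFinD lte_fin expr0 mulr1.
    have : theta * m <= 1 / 2 * m by rewrite ler_pM2r// theta_le.
    by lra.
  have yz : mdist y z <= 2 * rho.
    by have := metric_triangle y x z; rewrite (metric_sym y x); lra.
  apply: (dist_trans uz (B := 4 * eta)).
  apply: (le_trans (grad_step Ny Nz yz gy gz)); rewrite lee_fin.
  have -> : (2 * rho) `^ s * (2 * lev 0) = 2 `^ s * (2 * eta).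
    rewrite /lev expr0 mul1r powRM ?(ltW rho0)// powRN; field.
    by rewrite gt_eqF.
  have two : 2 `^ s <= (2 : R).
    have /andP[_ s1] := hs.
    by rewrite -[leRHS]powRr1// ler_powR// ler1n.
  by have := eta0; nra.
have /andP[sg0 sg1] : 0 < sg < 1 by rewrite sg_gt0 sg_lt1.
have sk0 : 0 < sg ^+ k by rewrite exprn_gt0.
have sk1 : sg ^+ k <= 1 by rewrite exprn_ile1 ?ltW.
have Rk (i : nat) : rho * (1 - sg * (1 - sg ^+ i) / 2) <= rho.
  rewrite ger_pMr// gerBl divr_ge0// mulr_ge0 ?(ltW sg0)// subr_ge0.
  by rewrite exprn_ile1 ?ltW.
have next z : mdist y z < rho * kap * sg ^+ k.+1 ->
    mdist x z < rho * (1 - sg * (1 - sg ^+ k) / 2).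
  move=> yz; have := metric_triangle x y z; move: xy yz; rewrite /chain_kappa exprS => xy yz.
  have -> : rho * (1 - sg * (1 - sg ^+ k) / 2) = rho * (1 - sg * (1 - sg * sg ^+ k) / 2)
    + rho * ((1 - sg) / 2) * (sg * sg ^+ k) by field.
  lra.
have [z [Nz yz gz]] := find_low (lt_le_trans xy (Rk _))
  (fun z yz => lt_le_trans (next z yz) (Rk _)).
have uz := IH z Nz (next z yz) gz.
rewrite big_ord_recr/= addrA; apply: (dist_trans uz).
have gz' : (g z <= (lev k.+1)%:E)%E by apply: (le_trans gz); rewrite lee_fin lev_le.
apply: (le_trans (grad_step Ny Nz (ltW yz) gy gz')); rewrite lee_fin.
rewrite le_eqVlt; apply/orP; left; apply/eqP.
rewrite /lev /chain_step powRM ?mulr_ge0 ?exprn_ge0 ?(ltW rho0) ?(ltW kap_gt0) ?(ltW sg0)//.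
rewrite powRM ?(ltW rho0) ?(ltW kap_gt0)// powR_exp ?(ltW sg0)// powRN exprMn; field.
by rewrite gt_eqF.
by rewrite subr_ge0 ltW.
Qed.

Let lev_unbounded (b : R) : exists k, b <= lev k.
Proof.
have e0 : 0 < eta * rho `^ (- s) by rewrite mulr_gt0// powR_gt0.
have bern k : 1 + k%:R * (L - 1) <= L ^+ k.
  elim: k => [|k IHk]; first by rewrite mul0r addr0 expr0.
  rewrite exprS -natr1; have L1 : 1 <= L ^+ k by rewrite exprn_ege1// ltW.
  have := hL; nra.
pose k := Num.bound `|b / (eta * rho `^ (- s)) / (L - 1)|.
exists k; rewrite /lev -mulrA -ler_pdivrMr//.
apply: le_trans (bern k).
have : b / (eta * rho `^ (- s)) / (L - 1) <= k%:R.
  by apply: (le_trans (ler_norm _)); apply/ltW/archi_boundP.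
rewrite ler_pdivrMr ?subr_gt0//; lra.
Qed.

Lemma chain_step_ge0 j : 0 <= chain_step eta j.
Proof.
by rewrite mulr_ge0 ?exprn_ge0 ?mulr_ge0 ?powR_ge0 ?(ltW eta0) ?(ltW L0).
Qed.

Let half_ball (y : T) k : mdist x y < rho / 2 -> mdist x y < rho * (1 - sg * (1 - sg ^+ k) / 2).
Proof.
move=> /lt_le_trans; apply; rewrite ler_pM2l//.
have := sg_gt0; have := sg_lt1; have : 0 <= sg ^+ k <= 1.
  by rewrite exprn_ge0 ?exprn_ile1 ?(ltW sg_gt0) ?(ltW sg_lt1).
by move=> /andP[h1 h2] h3 h4; nra.
Qed.

(** [chain_bound] for the least k such that g y is at most the k-th level: then y
    lies in all level sets of index below k. *)
Lemma chain_pointwise (y : T) : ~ N y -> mdist x y < rho / 2 -> (g y < +oo)%E ->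
  (`|u y - a%:E| <= (eps + 4 * eta)%:E + \sum_(0 <= j <oo)
     (chain_step eta j)%:E * (\1_(level_set s g L eta j (x, rho)) y)%:E)%E.
Proof.
move=> Ny xy gy.
have [k0 hk0] : exists k, (g y <= (lev k)%:E)%E.
  have gE : g y = (fine (g y))%:E by rewrite fineK// ge0_fin_numE.
  by have [k kE] := lev_unbounded (fine (g y)); exists k; rewrite gE lee_fin.
have [k hk kmin] := ex_minnP (ex_intro (fun k => (g y <= (lev k)%:E)%E) k0 hk0).
apply: (le_trans (chain_bound Ny (half_ball k xy) hk)); rewrite EFinD; apply: leeD => //.
apply: (le_trans _ (nneseries_lim_ge k _)); last first.
  by move=> j _ _; rewrite mule_ge0// lee_fin chain_step_ge0.
rewrite big_mkord -sumEFin; apply: lee_sum => j _.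
rewrite indicE mem_set ?mule1//; split => /=.
  rewrite ltNge; apply/negP => gj; have := kmin j gj.
  by rewrite leqNgt ltn_ord.
apply/ball_mdistP; apply: (lt_le_trans xy).
by have := rho0; lra.
Qed.

Definition chain_sum : R :=
  4 + 2 * kap `^ s * (sg `^ s * L) * theta / (1 - sg `^ s * L * tau).

Hypothesis hreg : borel_regular mu.
Hypotheses (mu_u : mu_measurable mu u) (mu_g : mu_measurable mu g).
Hypothesis gfin : mu [set y | `|g y|%E = +oo%E] = 0%E.
Hypothesis ratio : sg `^ s * L * tau < 1.

(** Each term of [chain_pointwise] integrates to at most chain_step j times
    theta tau^j mu(B(x,rho)). *)
Lemma chain_integral : (mu_integral mu (ball x (rho / 2)) (fun y => `|u y - a%:E|) <=
  (eps + eta * chain_sum)%:E * mu (ball x rho))%E.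
Proof.
pose X := caratheodory_type mu; pose D : set X := ball x (rho / 2).
have mD : measurable D by exact: measurable_metric_ball.
pose f (j : nat) (y : T) : \bar R := ((chain_step eta j)%:E *
   (\1_(level_set s g L eta j (x, rho)) y)%:E)%E.
have mlev j : measurable (level_set s g L eta j (x, rho) : set X).
  by apply: measurableI; [exact: measurable_superlevel|exact: measurable_metric_ball].
have mf j : measurable_fun D (f j : X -> \bar R).
  apply: emeasurable_funM => //; apply/measurable_EFinP; exact: measurable_indic.
have f0 j y : (0 <= f j y)%E by rewrite mule_ge0// lee_fin chain_step_ge0.
have e0 : 0 <= eps + 4 * eta by have := eps0; have := eta0; lra.
have muD : (mu D <= mu (ball x rho))%E.
  by apply: le_outer_measure; apply: le_ball; have := rho0; lra.
have [m m0 mE] := ball_fin hball x rho0.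
apply: (@le_trans _ _ (mu_integral mu D
   (fun y => (eps + 4 * eta)%:E + \sum_(0 <= j <oo) f j y)%E)).
  apply: ae_ge0_le_integral => //.
  - apply: measurableT_comp => //; apply: emeasurable_funB => //.
    exact: measurable_funS mu_u.
  - by move=> y _; rewrite adde_ge0 ?lee_fin// nneseries_ge0.
  - by apply: emeasurable_funD => //; exact: ge0_emeasurable_sum.
  (* A Borel hull makes the exceptional null set measurable. *)
  have [B [BB NB muB]] := hreg.2 (N `|` [set y | `|g y|%E = +oo%E]).
  have B0 : mu B = 0%E.
    apply/eqP; rewrite eq_le outer_measure_ge0 andbT.
    rewrite muB (le_trans (outer_measureU2 _ _ _))//.
    by rewrite N0 gfin adde0.
  exists B; split; [exact: hreg.1|exact: B0|].
  move=> y ny; apply: NB; apply: contrapT => /not_orP[Ny /= gy]; apply: ny => Dy.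
  apply: chain_pointwise => //; first exact/ball_mdistP.
  by rewrite ltey; apply/eqP => gE; apply: gy; rewrite gE.
rewrite /mu_integral ge0_integralD//; last first.
  - exact: ge0_emeasurable_sum.
  - by move=> y _; rewrite nneseries_ge0.
rewrite integral_cst// integral_nneseries//.
have -> : ((eps + eta * chain_sum)%:E * mu (ball x rho) =
    (eps + 4 * eta)%:E * mu (ball x rho) + (eta * (chain_sum - 4))%:E * mu (ball x rho))%E.
  by rewrite mE -!EFinM -EFinD; congr _%:E; ring.
apply: leeD; first by rewrite lee_wpmul2l.
set be := sg `^ s * L.
have be0 : 0 < be by rewrite mulr_gt0 ?powR_gt0 ?sg_gt0.
pose C := 2 * kap `^ s * eta * be * theta * m.
have th0 := theta_gt0.
have C0 : 0 <= C.
  rewrite mulr_ge0 ?(ltW m0)// mulr_ge0 ?(ltW th0)// mulr_ge0 ?(ltW be0)//.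
  by rewrite mulr_ge0 ?(ltW eta0)// mulr_ge0// powR_ge0.
have bt0 : 0 < be * tau by rewrite mulr_gt0// tau_gt0.
have step j : (\int[mu : set X -> \bar R]_(y in D) f j y <= (C * (be * tau) ^+ j)%:E)%E.
  rewrite (@ge0_integralZl_EFin _ _ _ (mu : set X -> \bar R) D mD)//; last 2 first.
  - by apply/measurable_EFinP; exact: measurable_indic.
  - exact: chain_step_ge0.
  rewrite integral_indic//.
  apply: (@le_trans _ _ ((chain_step eta j)%:E * ((theta * tau ^+ j)%:E * mu (ball x rho)))%E).
    rewrite lee_wpmul2l ?lee_fin ?chain_step_ge0//.
    apply: (le_trans _ (ltW (good j))); apply: le_outer_measure; exact: subIsetl.
  rewrite mE -!EFinM lee_fin le_eqVlt; apply/orP; left; apply/eqP.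
  by rewrite /C /chain_step -/be (exprMn _ be) (exprS be); ring.
apply: lime_le; first by apply: is_cvg_nneseries => j _ _; exact: integral_ge0.
apply: nearW => n.
apply: (@le_trans _ _ (series (geometric C (be * tau)) n)%:E).
  rewrite /series/= -sumEFin; apply: lee_sum => j _; exact: step.
rewrite mE -EFinM lee_fin.
apply: (le_trans (geometric_le_lim n C0 bt0 _)); first by rewrite gtr0_norm.
rewrite le_eqVlt; apply/orP; left; apply/eqP.
rewrite /C /chain_sum -/be; field.
by rewrite gt_eqF// subr_gt0.
Qed.

End Chain.

(** * Lebesgue points *)

Section LebesguePoints.
Context {R : realType} {T : pointedMetricType R}.
Variable mu : {outer_measure set T -> \bar R}.
Hypothesis hreg : borel_regular mu.
Hypothesis hball : balls_pos_finite mu.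

(** A mean oscillation bounded by mu(B) makes u integrable on B, so that its mean
    is not of the form oo - oo. *)
Lemma mean_oscillation_lebesgue_point (u : T -> \bar R) (x : T) : mu_measurable mu u ->
  (`|u x| <> +oo)%E ->
  (forall d : R, 0 < d -> \forall r \near (0 : R)^'+,
     (mu_integral mu (ball x r) (fun y => `|u y - u x|) <= d%:E * mu (ball x r))%E) ->
  lebesgue_point mu u x.
Proof.
move=> mu_u ux osc; pose X := caratheodory_type mu.
have ufin : u x \is a fin_num by rewrite fin_num_abs ltey; exact/eqP.
move: osc; rewrite /lebesgue_point -(fineK ufin); set a := fine (u x) => osc.
have mB r : measurable (ball x r : set X) by exact: measurable_metric_ball.
have mua : measurable_fun [set: X] (fun y : X => u y - a%:E)%E.
  by apply: emeasurable_funB.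
have near_int d r : 0 < r ->
    (mu_integral mu (ball x r) (fun y => `|u y - a%:E|) <= d%:E * mu (ball x r))%E ->
  [/\ (mu : set X -> \bar R).-integrable (ball x r) (u : X -> \bar R),
    (mu : set X -> \bar R).-integrable (ball x r) (fun y : X => u y - a%:E)%E &
    mu_integral mu (ball x r) u =
    (mu_integral mu (ball x r) (fun y => u y - a%:E) + a%:E * mu (ball x r))%E].
  move=> r0 hr; have [m m0 mE] := ball_fin hball x r0.
  have i1 : (mu : set X -> \bar R).-integrable (ball x r) (fun y : X => u y - a%:E)%E.
    apply/integrableP; split; first exact: measurable_funS mua.
    by apply: (le_lt_trans hr); rewrite mE -EFinM ltry.
  have i2 : (mu : set X -> \bar R).-integrable (ball x r) (cst a%:E).
    apply/integrableP; split => //.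
    rewrite (_ : (fun _ => _) = cst `|a|%:E)// integral_cst//.
    by rewrite [X in (_ * X)%E]mE -EFinM ltry.
  have uE : (u : X -> \bar R) = ((fun y => u y - a%:E) \+ cst a%:E)%E.
    apply/funext => y; symmetry; exact: (@subeK R (u y) a%:E).
  split => //; first by rewrite uE; exact: integrableD.
  by rewrite /mu_integral {1}uE integralD// integral_cst.
split.
  near=> r; have r0 : 0 < r by [].
  have [|iu _ _] := near_int 1 r r0; first by near: r; exact: osc.
  have h1 := integrable_pos_fin_num (mB r) iu.
  have h2 := integrable_neg_fin_num (mB r) iu.
  by rewrite fin_num_adde_defr.
apply: cvg_EFin_dist => d d0; near=> r; have r0 : 0 < r by [].
have hr : (mu_integral mu (ball x r) (fun y => `|u y - a%:E|) <= d%:E * mu (ball x r))%E.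
  by near: r; exact: osc.
have [iu iua ->] := near_int _ _ r0 hr.
have [m m0 mE] := ball_fin hball x r0.
set I := mu_integral mu (ball x r) (fun y => (u y - a%:E)%E).
have : (`|I| <= d%:E * mu (ball x r))%E.
  apply: le_trans hr; apply: le_abse_integral => //; exact: measurable_int iua.
rewrite mE; case: I => [b| |] //.
rewrite /= -!EFinM -EFinD inver gt_eqF// -EFinM !lee_fin ler_norml => /andP[h1 h2].
rewrite -(ler_pM2l m0 (a - d)) -(ler_pM2l m0 _ (a + d)) mulVKf ?gt_eqF//.
by apply/andP; split; nra.
Unshelve. all: by end_near. Qed.

End LebesguePoints.

Lemma near_right_double (R : realType) (P : R -> Prop) :
  (\forall r \near (0 : R)^'+, P r) -> \forall r \near (0 : R)^'+, P (2 * r).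
Proof.
move=> [e /= e0 he]; near=> r; have r0 : 0 < r by [].
apply: he => /=; last by rewrite mulr_gt0.
rewrite sub0r normrN gtr0_norm ?mulr_gt0// mulrC -ltr_pdivlMr//.
by near: r; apply: nbhs_right_lt; rewrite divr_gt0.
Unshelve. all: by end_near. Qed.

Section ChainExponents.
Context {R : realType}.

(** As tau = L^-p1, the left-hand side is 2^(q/p) L^(-q (1 - p1/p)), which tends to
    0 as L grows. *)
Lemma exists_level_ratio (p q p1 : R) : 0 < p -> 0 < q -> p1 < p ->
  exists2 L : R, 1 < L &
    2 `^ (q / p) * (chain_tau p1 L)^-1 `^ (q / p) * L `^ (- q) <= 2^-1.
Proof.
move=> p0 q0 p1p; pose w := q * (1 - p1 / p).
have w0 : 0 < w by rewrite mulr_gt0// subr_gt0 ltr_pdivrMr ?mul1r.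
pose e := (q / p + 1) / w.
have e0 : 0 < e by rewrite divr_gt0// addr_gt0// divr_gt0.
exists (2 `^ e).
  by have := gt0_ltr_powR e0 (x:=1) (y:=2); rewrite powR1; apply; rewrite ?nnegrE// ltr1n.
have two0 : 2 != 0 :> R by [].
rewrite /chain_tau -!powRrM -powRN -powRrM -!powRD ?two0 ?implybT//.
rewrite -(powR_inv1 (ler0n R 2)) ler_powR ?ler1n//.
rewrite le_eqVlt; apply/orP; left; apply/eqP.
rewrite /e /w; field.
by rewrite !gt_eqF// subr_gt0.
Qed.

(** The product is L^(1 - p1 (Q+s) / Q). *)
Lemma chain_ratio (Q s p1 L : R) : 0 < Q -> 0 < s -> 1 < L -> Q / (Q + s) < p1 ->
  chain_sigma Q p1 L `^ s * L * chain_tau p1 L < 1.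
Proof.
move=> Q0 s0 L1 hp.
have L0 : L != 0 by rewrite gt_eqF// (lt_trans _ L1).
rewrite /chain_sigma /chain_tau -{2}(powRr1 (ltW (lt_trans ltr01 L1))) -powRrM.
rewrite -!powRD ?L0 ?implybT//.
have -> : - (p1 / Q) * s + 1 - p1 = - ((p1 * (Q + s) - Q) / Q).
  by field; rewrite gt_eqF.
apply: powR_lt1 => //; rewrite divr_gt0// subr_gt0.
by rewrite -ltr_pdivrMr// addr_gt0.
Qed.

End ChainExponents.

Section PolarNonLebesgue.
Context {R : realType} {T : pointedMetricType R}.
Variable mu : {outer_measure set T -> \bar R}.
Variables (s p q c Q cd : R).
Hypothesis hs : (0 < s <= 1)%R.
Hypotheses (p0 : (0 < p)%R) (q0 : (0 < q)%R).
Hypothesis hreg : borel_regular mu.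
Hypothesis hball : balls_pos_finite mu.
Hypothesis cd0 : (0 < cd)%R.
Hypothesis hcd : forall (x : T) (r : R), (0 < r)%R ->
  (mu (ball x (2 * r)%R) <= cd%:E * mu (ball x r))%E.
Hypotheses (hc : 0 < c) (hQ : 0 < Q).
Hypothesis hlow : forall (x y : T) (r rho : R), 0 < r -> r <= rho -> ball x rho y ->
  ((c * (r / rho) `^ Q)%:E <= mu (ball y r) / mu (ball x rho))%E.

(** Off a polar set u is approximately continuous at x and the superlevel bounds
    hold for all eta = 1 / (n+1).  The chain is run in B(x, 2 r), and doubling
    compares mu(B(x, 2 r)) with mu(B(x, r)). *)
Lemma polar_not_lebesgue_point (u : T -> \bar R) : Q / (Q + s) < p ->
  hajlasz_hom mu (lorentz_norm mu p q) s u ->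
  quasicontinuous mu (lorentz_norm mu p q) s u ->
  polar mu s p q [set x | ~ lebesgue_point mu u x].
Proof.
move=> hQp hu qu; have s0 : 0 < s by case/andP : hs.
have [g [[mg g0 [N N0 ug]] gg gfin]] := hajlasz_hom_gradient q0 hu.
(* The midpoint: p1 < p lets the superlevel estimates be summed over the levels,
   Q / (Q + s) < p1 lets the chain be integrated. *)
pose p1 := (Q / (Q + s) + p) / 2.
have Qs0 : 0 < Q / (Q + s) by rewrite divr_gt0// addr_gt0.
have p10 : 0 < p1 by rewrite /p1; lra.
have Qp1 : Q / (Q + s) < p1 by rewrite /p1; lra.
have p1p : p1 < p by rewrite /p1; lra.
have [L L1 hL] := exists_level_ratio p0 q0 p1p.
have ratio := chain_ratio hQ s0 L1 Qp1.
pose theta := chain_theta c Q p1 L.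
have th0 : 0 < theta by exact: theta_gt0.
have tau0 : 0 < chain_tau p1 L by exact: tau_gt0.
have sg0 : 0 < chain_sigma Q p1 L by exact: sg_gt0.
pose K := chain_sum c Q s p1 L.
have K0 : 0 < K.
  rewrite /K /chain_sum ltr_pwDl// divr_ge0//; last by rewrite subr_ge0 ltW.
  rewrite mulr_ge0 ?(ltW th0)// mulr_ge0// ?mulr_ge0 ?powR_ge0//.
  by rewrite ltW// (lt_trans _ L1).
have pd := polar_not_dens_close_all hs p0 q0 hreg hball cd0 hcd hu qu.
have pl : polar mu s p q (\bigcup_n [set x | ~ exists2 r0 : R, 0 < r0 &
    forall r, 0 < r < r0 -> forall j, (mu (level_set s g L n.+1%:R^-1 j (x, r)) <
      (theta * chain_tau p1 L ^+ j)%:E * mu (ball x r))%E]).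
  apply: polar_bigcup => // n.
  by apply: (polar_bad_levels hs p0 q0 hreg hball cd0 hcd) => //; rewrite ltW.
apply: sub_polar (polarU p0 q0 pd pl) => x /= nleb.
apply: contrapT => /not_orP[/contrapT[ux du] nl]; apply: nleb.
apply: mean_oscillation_lebesgue_point => //; first by have [[]] := hu.
have ufin : u x \is a fin_num by rewrite fin_num_abs ltey; exact/eqP.
move=> d d0.
have K20 : 0 < d / (2 * cd * K) by rewrite divr_gt0// !mulr_gt0.
have [n hn] := ltr_add_invr K20; rewrite add0r in hn.
have [r1 r10 lr1] : exists2 r0 : R, 0 < r0 &
    forall r, 0 < r < r0 -> forall j, (mu (level_set s g L n.+1%:R^-1 j (x, r)) <
      (theta * chain_tau p1 L ^+ j)%:E * mu (ball x r))%E.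
  by apply: contrapT => nr; apply: nl; exists n.
(* Each of eps and eta K is given half of d / cd. *)
pose eps := d / (2 * cd); have eps0 : 0 < eps by rewrite divr_gt0// mulr_gt0.
have half0 : 0 < 2^-1 :> R by [].
have dd := near_right_double (du _ half0 _ eps0).
near=> r; have r0 : 0 < r by [].
have r20 : 0 < 2 * r by rewrite mulr_gt0.
have dens : (mu (ball x (2 * r) `&` [set y | (eps%:E < `|u y - u x|)%E]) <
  (2^-1)%:E * mu (ball x (2 * r)))%E by near: r; exact: dd.
have good j : (mu (level_set s g L n.+1%:R^-1 j (x, (2 * r)%R)) <
      (theta * chain_tau p1 L ^+ j)%:E * mu (ball x (2 * r)))%E.
  apply: lr1; rewrite r20/= mulrC -ltr_pdivlMr//.
  by near: r; apply: nbhs_right_lt; rewrite divr_gt0.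
rewrite -(fineK ufin) in dens *.
have gnull := gradable_lorentz_L0 p0 q0 gg gfin.
have := chain_integral hball hc hQ hlow hs p10 L1 r20 eps0 (_ : 0 < n.+1%:R^-1)
  N0 g0 ug good dens hreg _ mg gnull ratio.
rewrite (_ : 2 * r / 2 = r); last by field.
move=> /(_ _ _) H; apply: (le_trans (H _ _)) => //; first by have [[]] := hu.
have [m m0 mE] := ball_fin hball x r0.
have [m2 m20 m2E] := ball_fin hball x r20.
have := hcd x r0; rewrite m2E mE -!EFinM !lee_fin => hm.
have : n.+1%:R^-1 * K <= d / (2 * cd).
  by rewrite -ler_pdivlMr//; apply: (le_trans (ltW hn)); rewrite invfM mulrA.
rewrite -/K -/eps => h1.
apply: (@le_trans _ _ ((2 * eps) * (cd * m))).
  apply: ler_pM => //; [|exact: ltW|by rewrite mulr_natl mulr2n lerD2l].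
  by rewrite addr_ge0 ?(ltW eps0)// mulr_ge0 ?(ltW K0).
rewrite /eps le_eqVlt; apply/orP; left; apply/eqP; field.
by rewrite gt_eqF.
Unshelve. all: by end_near. Qed.

End PolarNonLebesgue.

Unset Implicit Arguments.
Theorem theorem7p3 (R : realType) (T : pointedMetricType R)
  (mu : {outer_measure set T -> \bar R})
  (hreg : borel_regular mu) (hball : balls_pos_finite mu) (hdbl : doubling mu)
  (c Q : R) (hc : 0 < c) (hQ : 0 < Q)
  (hlow : forall (x y : T) (r rho : R), 0 < r -> r <= rho -> ball x rho y ->
    ((c * (r / rho) `^ Q)%:E <= mu (ball y r) / mu (ball x rho))%E)
  (s p q : R) (hs : 0 < s <= 1) (hp : 0 < p) (hq : 0 < q)
  (u : T -> \bar R)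
  (hu : hajlasz_hom mu (lorentz_norm mu p q) s u)
  (huqc : quasicontinuous mu (lorentz_norm mu p q) s u) :
  quasieverywhere mu (lorentz_norm mu p q) s (gen_lebesgue_point mu u) /\
  (Q / (Q + s) < p ->
   quasieverywhere mu (lorentz_norm mu p q) s (lebesgue_point mu u)).
Proof.
have [cd cd0 hcd] := hdbl; split.
  have polarZ := polar_not_dens_close_all hs hp hq hreg hball cd0 hcd hu huqc.
  exists [set x | ~ (`|u x|%E <> +oo%E /\
    forall gamma, 0 < gamma -> dens_close mu u gamma x)].
    exact: polar_capacity hp hq _ polarZ.
  by move=> x /contrapT[ux ud]; exact: dens_close_gen_lebesgue.
move=> hQp; exists [set x | ~ lebesgue_point mu u x].
  apply: (polar_capacity hp hq).
  exact: (polar_not_lebesgue_point hs hp hq hreg hball cd0 hcd hc hQ hlow).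
by move=> x /contrapT.
Qed.
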